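(* Let $K=K_1\times\cdots\times K_\nu\subseteq\mathbb R^n$, where each block $K_i$ is either $\mathbb R_+$ (put $n_i=1$) or a Lorentz cone $\mathcal L_{n_i}$ with $n_i\ge 2$, so $n=\sum_i n_i$. Let $A\in\mathbb R^{m\times n}$, $b\in\mathbb R^m$, $c\in\mathbb R^n$ be arbitrary, and consider the primal program $$(P)\qquad p^*=\inf\{\langle c,x\rangle: Ax=b,\ x\in K\}.$$ Let $T=\operatorname{rank}K$ and let $(D_{\mathrm{SOCP}})$ be the program $$ \begin{aligned} \sup\quad & b^T\eta\\ \text{subject to}\quad & y_j=A^T\lambda_j,\quad b^T\lambda_j=0 && (1\le j\le T),\\ & y_{T+1}=c-A^T\eta,\\ & y_j=q_j+z_j,\quad q_j\in K && (1\le j\le T+1),\\ & z_1=0,\quad z_j\in\operatorname{tan}'(q_{j-1},K) && (2\le j\le T+1), \end{aligned} $$ with $\eta,\lambda_1,\dots,\lambda_T\in\mathbb R^m$ and $y_j,q_j,z_j\in\mathbb R^n$, where each membership $z_j\in\operatorname{tan}'(q_{j-1},K)$ is expanded through its own fresh set of auxiliary variables $w_{ji},v_{jiR}^+,v_{jiR}^-\in K_i$ ($1\le i\le\nu$, $R\in\mathcal R_i$) and the affine equations defining $\operatorname{tan}'$ (see context). Then: 1. Every feasible point of $(D_{\mathrm{SOCP}})$ gives a lower bound on $(P)$: its objective value satisfies $b^T\eta\le\langle c,x\rangle$ for every $x$ feasible for $(P)$. 2. If $(P)$ is feasible and $p^*>-\infty$, then $(D_{\mathrm{SOCP}})$ attains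 $p^*$, i.e. it has a feasible point with $b^T\eta=p^*$ (which is then optimal). No constraint qualification is assumed. 3. The scalar formulation size of $(D_{\mathrm{SOCP}})$ is $$O\!\left(T\sum_{i=1}^\nu n_i^3+T\,\operatorname{size}(A,b,c)\right),$$ where $\operatorname{size}(A,b,c)$ denotes the number of scalar coefficient occurrences of the input data in the displayed primal formulation $(P)$.
   Context: For $d\ge2$, $\mathcal L_d=\{(t,z)\in\mathbb R\times\mathbb R^{d-1}: t\ge\|z\|_2\}$ is the Lorentz cone. The rank is defined by $\operatorname{rank}\mathcal L_d=2$, $\operatorname{rank}\mathbb R_+=1$, and is additive over products. Fixed map families. For a Lorentz block $K_i=\mathcal L_{n_i}$, index coordinates by $0,\dots,n_i-1$, with coordinate vectors $e_a$, and set $J=\operatorname{diag}(1,-1,\dots,-1)$, $S_{ab}=e_ae_b^T-e_be_a^T$; then $\mathcal R_i=\{I_{n_i}\}\cup\{S_{ab}J:0\le a<b<n_i\}$. For a scalar block $K_i=\mathbb R_+$, $\mathcal R_i=\{I_1\}$. The mapping $\operatorname{tan}'$. For $u=(u_1,\dots,u_\nu)\in K$ and $z=(z_1,\dots,z_\nu)\in\mathbb R^n$ (partitioned by blocks), $z\in\operatorname{tan}'(u,K)$ if and only if for every $i$ there are $w_i,v_{iR}^+,v_{iR}^-\in K_i$ ($R\in\mathcal R_i$) with $$u_i=w_i+\sum_{R\in\mathcal R_i}(v_{iR}^++v_{iR}^-),\qquad z_i=\sum_{R\in\mathcal R_i}R(v_{iR}^+-v_{iR}^-).$$ Thus the expanded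 program has only affine equations and memberships in the cone blocks $K_i$. Its primary variables are $\eta,\lambda_j,q_j,w_{ji},v_{jiR}^+,v_{jiR}^-$; the symbols $y_j,z_j$ are affine abbreviations. Free scalars may be split into differences of nonnegative scalars, and a nonnegative scalar $s$ may be represented by $(s,0)\in\mathcal L_2$. The scalar formulation size is the total number of scalar decision-variable components, scalar affine equations, and coefficient occurrences. A variable in $\mathcal L_d$ contributes $d$ scalar components, and each real coefficient is treated as one atomic scalar. The implied constant in $O(\cdot)$ is absolute. *)

(* Defs.v *)
From HB Require Import structures.
From mathcomp Require Import all_boot all_order all_algebra.
From mathcomp Require Import boolp classical_sets reals constructive_ereal ereal.

Set Implicit Arguments.
Unset Strict Implicit.
Unset Printing Implicit Defensive.

Import Order.TTheory GRing.Theory Num.Theory.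

Local Open Scope ring_scope.

(* [Lorentz k] is the Lorentz cone L_{k+2}: the condition d >= 2 is built in. *)
Inductive block := Nonneg | Lorentz of nat.

Definition bdim (B : block) : nat :=
  match B with Nonneg => 1 | Lorentz k => k.+2 end.

Definition brank (B : block) : nat :=
  match B with Nonneg => 1 | Lorentz _ => 2 end.

Definition in_block (R : rcfType) (B : block) : 'cV[R]_(bdim B) -> Prop :=
  match B with
  | Nonneg => fun u => 0 <= u ord0 ord0
  | Lorentz k => fun u =>
      Num.sqrt (\sum_(a < k.+1) u (lift ord0 a) ord0 ^+ 2) <= u ord0 ord0
  end.
Arguments in_block {R} B u.

(* R^n is ['cV_(\sum_i bdim (K i))]; the i-th block of x is [submxcol x i], and
   [tagnat.Rank i a] is the position in R^n of the a-th coordinate of block i. *)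
Notation cdim K := (\sum_i bdim (K i))%N.

Definition rank nu (K : 'I_nu -> block) : nat := \sum_i brank (K i).

Definition in_cone (R : rcfType) nu (K : 'I_nu -> block)
    (x : 'cV[R]_(cdim K)) : Prop :=
  forall i, in_block (K i) (submxcol x i).
Arguments in_cone {R nu} K x.

Definition dotv (R : pzRingType) n (u v : 'cV[R]_n) : R :=
  \sum_k u k ord0 * v k ord0.

Definition primal_feasible (R : rcfType) nu (K : 'I_nu -> block) m
    (A : 'M[R]_(m, cdim K)) (b : 'cV[R]_m) (x : 'cV[R]_(cdim K)) : Prop :=
  A *m x = b /\ in_cone K x.
Arguments primal_feasible {R nu} K {m} A b x.

Definition primal_value (R : realType) nu (K : 'I_nu -> block) m
    (A : 'M[R]_(m, cdim K)) (b : 'cV[R]_m) (c : 'cV[R]_(cdim K)) : \bar R :=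
  ereal_inf [set (dotv c x)%:E | x in [set x | primal_feasible K A b x]]%classic.
Arguments primal_value {R nu} K {m} A b c.

(* [None] indexes the identity and [Some (a, b)] the map S_ab J. For n = 1 there
   is no pair a < b, so that the family of a scalar block is {I_1}. *)
Definition rmap (n : nat) := option {p : 'I_n * 'I_n | (p.1 < p.2)%N}.

Definition Jmx (R : pzRingType) n : 'M[R]_n :=
  diag_mx (\row_(a < n) (if a == 0%N :> nat then 1 else -1)).

Definition Smx (R : pzRingType) n (a b : 'I_n) : 'M[R]_n :=
  delta_mx a b - delta_mx b a.

Definition rmap_mx (R : pzRingType) n (r : rmap n) : 'M[R]_n :=
  match r with
  | None => 1%:M
  | Some p => Smx R (val p).1 (val p).2 *m Jmx R n
  end.

Definition tan' (R : rcfType) nu (K : 'I_nu -> block)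
    (u z : 'cV[R]_(cdim K)) : Prop :=
  forall i, exists w : 'cV[R]_(bdim (K i)),
    exists vp vm : rmap (bdim (K i)) -> 'cV[R]_(bdim (K i)),
  [/\ in_block (K i) w,
      forall r, in_block (K i) (vp r) /\ in_block (K i) (vm r),
      submxcol u i = w + \sum_r (vp r + vm r)
    & submxcol z i = \sum_r rmap_mx R r *m (vp r - vm r)].
Arguments tan' {R nu} K u z.

(* The displayed dual, with tan' not yet expanded. Indices are shifted by one:
   [lam j] is lambda_{j+1} and [y j], [q j], [z j] are y_{j+1}, q_{j+1},
   z_{j+1}. For j < T, [lift ord_max j] : 'I_T.+1 has value j and [lift ord0 j]
   has value j+1. *)
Definition displayed_dual (R : rcfType) nu (K : 'I_nu -> block) m
    (A : 'M[R]_(m, cdim K)) (b : 'cV[R]_m) (c : 'cV[R]_(cdim K))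
    (eta : 'cV[R]_m) (lam : 'I_(rank K) -> 'cV[R]_m)
    (y q z : 'I_(rank K).+1 -> 'cV[R]_(cdim K)) : Prop :=
  [/\ forall j, y (lift ord_max j) = A^T *m lam j /\ dotv b (lam j) = 0,
      y ord_max = c - A^T *m eta,
      forall j, y j = q j + z j /\ in_cone K (q j),
      z ord0 = 0
    & forall j, tan' K (q (lift ord_max j)) (z (lift ord0 j))].

(* Explicit conic programs. Variables are vectors, free or constrained to a
   cone block. An affine expression is the list of its coefficient occurrences;
   a pair [(a, None)] is the constant a and [(a, Some s)] is a times the scalar
   component s. *)
Inductive domain := Free of nat | Cone of block.

Definition ddim (D : domain) : nat :=
  match D with Free d => d | Cone B => bdim B end.

Definition in_domain (R : rcfType) (D : domain) : 'cV[R]_(ddim D) -> Prop :=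
  match D with Free d => fun=> True | Cone B => in_block B end.
Arguments in_domain {R} D u.

Definition component (V : finType) (dom : V -> domain) :=
  {x : V & 'I_(ddim (dom x))}.

Definition affine (R : rcfType) (V : finType) (dom : V -> domain) :=
  seq (R * option (component dom)).

(* Each member e of [equations] stands for the scalar equation e = 0. *)
Record program (R : rcfType) := Program {
  pvar : finType;
  pdom : pvar -> domain;
  pobj : affine R pdom;
  pequations : seq (affine R pdom)
}.

Definition point (R : rcfType) (V : Type) (dom : V -> domain) :=
  forall x : V, 'cV[R]_(ddim (dom x)).

Section Programs.
Variables (R : rcfType) (V : finType) (dom : V -> domain).
Implicit Types (s : point R dom) (e : affine R dom).

Definition term_value s (t : R * option (component dom)) : R :=
  match t.2 with
  | None => t.1
  | Some k => t.1 * s (tag k) (tagged k) ord0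
  end.

Definition affine_value s e : R := \sum_(t <- e) term_value s t.

Definition affine_opp e : affine R dom := [seq (- t.1, t.2) | t <- e].

Definition coef (a : R) (x : V) (k : 'I_(ddim (dom x))) :
    R * option (component dom) :=
  (a, Some (Tagged (fun x => 'I_(ddim (dom x))) k)).

End Programs.

Definition feasible (R : rcfType) (P : program R)
    (s : point R (@pdom R P)) : Prop :=
  (forall x, in_domain (pdom x) (s x)) /\
  (forall e, e \in pequations P -> affine_value s e = 0).
Arguments feasible {R} P s.

Definition objective (R : rcfType) (P : program R)
    (s : point R (@pdom R P)) : R := affine_value s (pobj P).
Arguments objective {R} P s.

Definition formulation_size (R : rcfType) (P : program R) : nat :=
  (\sum_(x : pvar P) ddim (pdom x) + size (pequations P)
   + (size (pobj P) + \sum_(e <- pequations P) size e))%N.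

(* Primary variables of the expanded dual, with the same index shift: [Q j i]
   is q_{j+1,i}, and [W j i], [Vp j r], [Vm j r] (r a map index of block i)
   are the auxiliary variables of z_{j+2} \in tan'(q_{j+1}, K). *)
Inductive dvar nu (K : 'I_nu -> block) :=
  | Eta
  | Lam of 'I_(rank K)
  | Q of 'I_(rank K).+1 & 'I_nu
  | W of 'I_(rank K) & 'I_nu
  | Vp (j : 'I_(rank K)) (i : 'I_nu) (r : rmap (bdim (K i)))
  | Vm (j : 'I_(rank K)) (i : 'I_nu) (r : rmap (bdim (K i))).
Arguments Eta {nu K}.
Arguments Lam {nu K}.
Arguments Q {nu K}.
Arguments W {nu K}.
Arguments Vp {nu K} j {i} r.
Arguments Vm {nu K} j {i} r.

Section DvarFinType.
Variables (nu : nat) (K : 'I_nu -> block).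
Local Notation T := (rank K).
Local Notation mapidx := {i : 'I_nu & rmap (bdim (K i))}.

Definition dvar_code : Type :=
  unit + 'I_T + 'I_T.+1 * 'I_nu + 'I_T * 'I_nu + 'I_T * mapidx + 'I_T * mapidx.

Definition dvar_encode (x : dvar K) : dvar_code :=
  match x with
  | Eta => inl (inl (inl (inl (inl tt))))
  | Lam j => inl (inl (inl (inl (inr j))))
  | Q j i => inl (inl (inl (inr (j, i))))
  | W j i => inl (inl (inr (j, i)))
  | Vp j i r => inl (inr (j, Tagged (fun i => rmap (bdim (K i))) r))
  | Vm j i r => inr (j, Tagged (fun i => rmap (bdim (K i))) r)
  end.

Definition dvar_decode (x : dvar_code) : dvar K :=
  match x with
  | inl (inl (inl (inl (inl _)))) => Eta
  | inl (inl (inl (inl (inr j)))) => Lam j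
  | inl (inl (inl (inr (j, i)))) => Q j i
  | inl (inl (inr (j, i))) => W j i
  | inl (inr (j, r)) => Vp j (tagged r)
  | inr (j, r) => Vm j (tagged r)
  end.

Lemma dvar_encodeK : cancel dvar_encode dvar_decode.
Proof. by case. Qed.

HB.instance Definition _ := Finite.copy (dvar K) (can_type dvar_encodeK).

End DvarFinType.

Section ExpandedDual.
Variables (R : rcfType) (nu : nat) (K : 'I_nu -> block) (m : nat).
Variables (A : 'M[R]_(m, cdim K)) (b : 'cV[R]_m) (c : 'cV[R]_(cdim K)).
Local Notation T := (rank K).

Definition dvar_dom (x : dvar K) : domain :=
  match x with
  | Eta | Lam _ => Free m
  | Q _ i | W _ i | Vp _ i _ | Vm _ i _ => Cone (K i)
  end.

Local Notation expr := (affine R dvar_dom).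
Local Notation "a *c x @ k" := (coef (dom := dvar_dom) a (x := x) k)
  (at level 40, x at level 9, k at level 9).

(* Every entry of the data A, b, c is an occurrence, whatever its value; of the
   fixed maps in R_i only the nonzero entries occur. *)
Definition obj_expr : expr := [seq b r ord0 *c Eta @ r | r <- enum 'I_m].

Definition orth_expr (j : 'I_T) : expr :=
  [seq b r ord0 *c (Lam j) @ r | r <- enum 'I_m].

Definition y_expr (j : 'I_T.+1) i (a : 'I_(bdim (K i))) : expr :=
  let k := tagnat.Rank i a in
  if unlift ord_max j is Some j' then
    [seq A r k *c (Lam j') @ r | r <- enum 'I_m]
  else (c k ord0, None) :: [seq (- A r k) *c Eta @ r | r <- enum 'I_m].

Definition z_expr (j : 'I_T.+1) i (a : 'I_(bdim (K i))) : expr :=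
  if unlift ord0 j is Some j' then
    flatten [seq
      flatten [seq [:: rmap_mx R r a k *c (Vp j' r) @ k;
                       (- rmap_mx R r a k) *c (Vm j' r) @ k]
              | k <- enum 'I_(bdim (K i)) & rmap_mx R r a k != 0]
      | r <- enum {: rmap (bdim (K i))}]
  else [::].

(* y_j - (q_j + z_j) = 0 *)
Definition y_equation j i a : expr :=
  y_expr j a ++ affine_opp (1 *c (Q j i) @ a :: z_expr j a).

(* q_j - (w + sum_r (v^+_r + v^-_r)) = 0 *)
Definition tan_equation (j : 'I_T) i (a : 'I_(bdim (K i))) : expr :=
  1 *c (Q (lift ord_max j) i) @ a ::
  affine_opp (1 *c (W j i) @ a ::
    flatten [seq [:: 1 *c (Vp j r) @ a; 1 *c (Vm j r) @ a]
            | r <- enum {: rmap (bdim (K i))}]).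

Definition dual_equations : seq expr :=
  [seq orth_expr j | j <- enum 'I_T] ++
  [seq y_equation j (tagged k)
     | j <- enum 'I_T.+1, k <- enum {: {i : 'I_nu & 'I_(bdim (K i))}}] ++
  [seq tan_equation j (tagged k)
     | j <- enum 'I_T, k <- enum {: {i : 'I_nu & 'I_(bdim (K i))}}].

Definition dsocp : program R := Program obj_expr dual_equations.

End ExpandedDual.
Arguments dsocp {R nu} K {m} A b c.

Section Agreement.
Variables (R : rcfType) (nu : nat) (K : 'I_nu -> block) (m : nat).
Variables (A : 'M[R]_(m, cdim K)) (b : 'cV[R]_m) (c : 'cV[R]_(cdim K)).
Local Notation T := (rank K).
Local Notation D := (dsocp K A b c).
Local Notation dom := (@dvar_dom nu K m).
Implicit Type s : point R dom.

Lemma affine_value_cat s (e f : affine R dom) :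
  affine_value s (e ++ f) = affine_value s e + affine_value s f.
Proof. exact: big_cat. Qed.

Lemma affine_value_opp s (e : affine R dom) :
  affine_value s (affine_opp e) = - affine_value s e.
Proof.
rewrite /affine_value big_map -sumrN; apply: eq_bigr => -[a [k|]] _ //=.
by rewrite /term_value /= mulNr.
Qed.

Lemma affine_value_cons s t (e : affine R dom) :
  affine_value s (t :: e) = term_value s t + affine_value s e.
Proof. exact: big_cons. Qed.

Lemma orth_value s (j : 'I_T) :
  affine_value s (orth_expr b j) = dotv b (s (Lam j)).
Proof. by rewrite /affine_value big_map big_enum. Qed.

Lemma dsocp_objective s : objective D s = dotv b (s Eta).
Proof. by rewrite /objective /affine_value big_map big_enum. Qed.

Definition y_of s (j : 'I_T.+1) : 'cV[R]_(cdim K) :=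
  if unlift ord_max j is Some j' then A^T *m s (Lam j') else c - A^T *m s Eta.

Definition z_of s (j : 'I_T.+1) : 'cV[R]_(cdim K) :=
  \mxcol_(i < nu)
    ((if unlift ord0 j is Some j' then
       \sum_r rmap_mx R r *m (s (Vp j' r) - s (Vm j' r) : 'cV_(bdim (K i)))
     else 0) : 'cV[R]_(bdim (K i))).

Lemma y_value s j i (a : 'I_(bdim (K i))) :
  affine_value s (y_expr A c j a) = submxcol (y_of s j) i a ord0.
Proof.
rewrite /y_expr /y_of mxE; case: unliftP => [j'|] _.
  rewrite /affine_value big_map big_enum mxE; apply: eq_bigr => r _.
  by rewrite mxE.
rewrite affine_value_cons /affine_value big_map big_enum !mxE -sumrN.
by congr (_ + _); apply: eq_bigr => r _; rewrite /term_value /= mxE mulNr.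
Qed.

Lemma z_value s j i (a : 'I_(bdim (K i))) :
  affine_value s (z_expr R m j a) = submxcol (z_of s j) i a ord0.
Proof.
rewrite /z_expr /z_of mxcolK; case: unliftP => [j'|] _; last first.
  by rewrite /affine_value big_nil mxE.
rewrite /affine_value big_flatten big_map big_enum /= summxE.
apply: eq_bigr => r _; rewrite big_flatten big_map big_filter big_enum_cond /=.
rewrite mxE [RHS](bigID (fun k => rmap_mx R r a k != 0)) /=.
rewrite [X in _ = _ + X]big1 ?addr0; last first.
  by move=> k; rewrite negbK => /eqP->; rewrite mul0r.
apply: eq_bigr => k _; rewrite !big_cons big_nil addr0 /term_value /= !mxE.
by rewrite mulrDr mulrN mulNr.
Qed.

Lemma tan_value s (j : 'I_T) i (a : 'I_(bdim (K i))) :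
  affine_value s (tan_equation R m j a) =
  (s (Q (lift ord_max j) i)
   - (s (W j i) + \sum_r (s (Vp j r) + s (Vm j r) : 'cV_(bdim (K i))))) a ord0.
Proof.
rewrite affine_value_cons affine_value_opp affine_value_cons.
rewrite /affine_value big_flatten big_map big_enum /term_value /= !mul1r !mxE.
congr (_ - (_ + _)); rewrite summxE; apply: eq_bigr => r _.
by rewrite !big_cons big_nil addr0 /= !mul1r mxE.
Qed.

Lemma y_equation_value s j i (a : 'I_(bdim (K i))) :
  affine_value s (y_equation A c j a) =
  (submxcol (y_of s j) i - (s (Q j i) + submxcol (z_of s j) i)) a ord0.
Proof.
rewrite affine_value_cat affine_value_opp affine_value_cons y_value z_value.
by rewrite /term_value /= mul1r !mxE.
Qed.

Lemma dsocp_feasibleP s :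
  feasible D s <->
  [/\ forall x, in_domain (dom x) (s x),
      forall j, dotv b (s (Lam j)) = 0,
      forall j i, submxcol (y_of s j) i = s (Q j i) + submxcol (z_of s j) i
    & forall j i, s (Q (lift ord_max j) i) =
        s (W j i) + \sum_r (s (Vp j r) + s (Vm j r) : 'cV_(bdim (K i)))].
Proof.
split=> [[sK sE]|[sK sO sY sT]].
  split=> // [j|j i|j i].
  - rewrite -orth_value; apply: sE; rewrite !mem_cat; apply/orP; left.
    by apply: map_f; rewrite mem_enum.
  - apply/eqP; rewrite -subr_eq0; apply/eqP/matrixP => a o; rewrite (ord1 o).
    rewrite [RHS]mxE -y_equation_value; apply: sE; rewrite !mem_cat.
    apply/orP; right; apply/orP; left; apply/allpairsPdep.
    by exists j, (Tagged (fun i => 'I_(bdim (K i))) a); rewrite !mem_enum.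
  - apply/eqP; rewrite -subr_eq0; apply/eqP/matrixP => a o; rewrite (ord1 o).
    rewrite [RHS]mxE -tan_value; apply: sE; rewrite !mem_cat.
    apply/orP; right; apply/orP; right; apply/allpairsPdep.
    by exists j, (Tagged (fun i => 'I_(bdim (K i))) a); rewrite !mem_enum.
split=> // e; rewrite !mem_cat => /or3P[/mapP[j _ ->]| |].
- by rewrite orth_value.
- move=> /allpairsPdep[j [k [_ _ ->]]].
  by rewrite y_equation_value sY subrr mxE.
- move=> /allpairsPdep[j [k [_ _ ->]]].
  by rewrite tan_value sT subrr mxE.
Qed.

(* The expanded program is the displayed dual: they have the same feasible
   (eta, lambda, q), and the same objective by [dsocp_objective]. *)
Lemma dsocp_displayed eta lam q :
  (exists y z, displayed_dual A b c eta lam y q z) <->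
  (exists2 s, feasible D s &
     [/\ s Eta = eta, forall j, s (Lam j) = lam j
       & forall j i, s (Q j i) = submxcol (q j) i]).
Proof.
split=> [[y [z [yl ym yq z0 zt]]]|[s /dsocp_feasibleP[sK sO sY sT] [sE sL sQ]]].
  have wE : forall ji : 'I_T * 'I_nu,
      exists w : 'cV[R]_(bdim (K ji.2)) *
        ((rmap (bdim (K ji.2)) -> 'cV[R]_(bdim (K ji.2))) *
         (rmap (bdim (K ji.2)) -> 'cV[R]_(bdim (K ji.2)))),
      [/\ in_block (K ji.2) w.1,
       forall r, in_block (K ji.2) (w.2.1 r) /\ in_block (K ji.2) (w.2.2 r),
       submxcol (q (lift ord_max ji.1)) ji.2 = w.1 + \sum_r (w.2.1 r + w.2.2 r)
     & submxcol (z (lift ord0 ji.1)) ji.2 =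
         \sum_r rmap_mx R r *m (w.2.1 r - w.2.2 r)].
    by move=> [j i]; have [w [vp [vm wP]]] := zt j i; exists (w, (vp, vm)).
  pose w ji := projT1 (cid (wE ji)); have wP ji := projT2 (cid (wE ji)).
  rewrite -/(w _) in wP.
  pose s : point R dom := fun x => match x with
    | Eta => eta | Lam j => lam j | Q j i => submxcol (q j) i
    | W j i => (w (j, i)).1
    | Vp j i r => (w (j, i)).2.1 r | Vm j i r => (w (j, i)).2.2 r end.
  exists s => //; apply/dsocp_feasibleP; split.
  - case=> //= [j i|j i|j i r|j i r]; first by have [_] := yq j; apply.
    + by have [] := wP (j, i).
    + by have [_ /(_ r)[]] := wP (j, i).
    + by have [_ /(_ r)[]] := wP (j, i).
  - by move=> j; have [] := yl j.
  - move=> j i; have -> : y_of s j = y j.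
      rewrite /y_of; case: unliftP => [j'|] -> //=.
      by have [] := yl j'.
    have -> : submxcol (z_of s j) i = submxcol (z j) i.
      rewrite mxcolK; case: unliftP => [j'|] -> /=; last by rewrite z0 submxcol0.
      by have [] := wP (j', i).
    by have [-> _] := yq j; rewrite submxcolD.
  - by move=> j i; have [] := wP (j, i).
exists (y_of s), (z_of s); split.
- by move=> j; rewrite /y_of liftK sL; split=> //; rewrite -sL sO.
- by rewrite /y_of unlift_none sE.
- move=> j; split=> [|i]; last by rewrite -sQ; apply: (sK (Q j i)).
  by apply/mxcolP => i; rewrite submxcolD sY sQ.
- apply/mxcolP => i; rewrite mxcolK submxcol0.
  by rewrite unlift_none.
- move=> j i; exists (s (W j i)), (fun r => s (Vp j r)), (fun r => s (Vm j r)).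
  split; first by apply: (sK (W j i)).
  + by move=> r; split; [apply: (sK (Vp j r)) | apply: (sK (Vm j r))].
  + by rewrite -sQ sT.
  + by rewrite mxcolK liftK.
Qed.

End Agreement.

(* Number of scalar entries of A, b and c. *)
Definition data_size (m n : nat) : nat := (m * n + m + n)%N.

(* Main.v *)
Require Import Defs.
From mathcomp Require Import all_boot all_order all_algebra.
From mathcomp Require Import ring lra zify.
From mathcomp Require Import boolp classical_sets reals constructive_ereal ereal.

(* Suppose that every feasible x is orthogonal to q \in K, so that
   it lies in the face F = K \cap q^perp. Properly separating 0 from the cone
   {(A x - t b, <c, x> - t p + s) : x \in F, t >= 0, s > 0}, with p a lower bound
   of (P), gives either eta with c - A^T eta \in F^* and <b, eta> >= p, or mu with
   <b, mu> = 0 and A^T mu \in F^* not orthogonal to F. In each block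
   F^* = K + F^perp, so that A^T mu = q' + z with q' \in K and z orthogonal to F;
   replacing q by q + q' then shrinks F strictly and lowers its rank, which is
   at most rank K at the start. Finally z is orthogonal to F exactly when
   z \in tan'(a q, K) for some a >= 0: for q on the boundary of a Lorentz block,
   F is the ray of J q and the vectors S_ab J q span its orthogonal. The scalars a
   are absorbed by rescaling the homogeneous part of the program. *)

Set Implicit Arguments.
Unset Strict Implicit.
Unset Printing Implicit Defensive.

Import Order.TTheory GRing.Theory Num.Theory.

Local Open Scope ring_scope.

(** * Bilinearity of the inner product and its behaviour under block decompositions *)

Section InnerProduct.
Variable R : comPzRingType.
Implicit Types (n m : nat) (a : R).

Lemma dotvE n (u v : 'cV[R]_n) : dotv u v = (u^T *m v) ord0 ord0.
Proof. by rewrite mxE; apply: eq_bigr => k _; rewrite mxE. Qed.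

Lemma dotvC n (u v : 'cV[R]_n) : dotv u v = dotv v u.
Proof. by apply: eq_bigr => k _; rewrite mulrC. Qed.

Lemma dotvDr n (u v w : 'cV[R]_n) : dotv u (v + w) = dotv u v + dotv u w.
Proof. by rewrite !dotvE mulmxDr mxE. Qed.

Lemma dotvNr n (u v : 'cV[R]_n) : dotv u (- v) = - dotv u v.
Proof. by rewrite !dotvE mulmxN mxE. Qed.

Lemma dotvBr n (u v w : 'cV[R]_n) : dotv u (v - w) = dotv u v - dotv u w.
Proof. by rewrite dotvDr dotvNr. Qed.

Lemma dotvZr n a (u v : 'cV[R]_n) : dotv u (a *: v) = a * dotv u v.
Proof. by rewrite !dotvE -scalemxAr mxE. Qed.

Lemma dotv0r n (u : 'cV[R]_n) : dotv u 0 = 0.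
Proof. by rewrite dotvE mulmx0 mxE. Qed.

Lemma dotvDl n (u v w : 'cV[R]_n) : dotv (u + v) w = dotv u w + dotv v w.
Proof. by rewrite dotvC dotvDr !(dotvC w). Qed.

Lemma dotvNl n (u v : 'cV[R]_n) : dotv (- u) v = - dotv u v.
Proof. by rewrite dotvC dotvNr dotvC. Qed.

Lemma dotvBl n (u v w : 'cV[R]_n) : dotv (u - v) w = dotv u w - dotv v w.
Proof. by rewrite dotvDl dotvNl. Qed.

Lemma dotvZl n a (u v : 'cV[R]_n) : dotv (a *: u) v = a * dotv u v.
Proof. by rewrite dotvC dotvZr dotvC. Qed.

Lemma dotv0l n (u : 'cV[R]_n) : dotv 0 u = 0.
Proof. by rewrite dotvC dotv0r. Qed.

Lemma dotv_suml n (I : finType) (F : I -> 'cV[R]_n) v :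
  dotv (\sum_i F i) v = \sum_i dotv (F i) v.
Proof.
by elim/big_rec2: _ => [|i a w _ <-]; rewrite ?dotv0l ?dotvDl.
Qed.

Lemma dotv_mulmxl n m (M : 'M[R]_(m, n)) (u : 'cV[R]_n) (v : 'cV[R]_m) :
  dotv (M *m u) v = dotv u (M^T *m v).
Proof. by rewrite !dotvE trmx_mul mulmxA. Qed.

Lemma dotv_col_mx m n (u u' : 'cV[R]_m) (v v' : 'cV[R]_n) :
  dotv (col_mx u v) (col_mx u' v') = dotv u u' + dotv v v'.
Proof. by rewrite !dotvE tr_col_mx mul_row_col mxE. Qed.

Lemma dotv_scalar (a a' : R) : dotv (a%:M : 'cV_1) a'%:M = a * a'.
Proof. by rewrite /dotv big_ord1 !mxE eqxx !mulr1n. Qed.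

Lemma dotv_submxcol nu (p : 'I_nu -> nat) (u v : 'cV[R]_(\sum_i p i)%N) :
  dotv u v = \sum_i dotv (submxcol u i) (submxcol v i).
Proof.
rewrite -{1}(submxcolK u) -{1}(submxcolK v) dotvE tr_mxcol mul_mxrow_mxcol.
by rewrite summxE; apply: eq_bigr => i _; rewrite dotvE.
Qed.

End InnerProduct.

(** * Positive definiteness, and proper separation of 0 from a convex cone *)

Lemma dotv_eq0 (R : realDomainType) n (u : 'cV[R]_n) : dotv u u = 0 -> u = 0.
Proof.
move=> uu; apply/matrixP => k o; rewrite (ord1 o) mxE.
have /psumr_eq0P/(_ k isT)/eqP : \sum_k u k ord0 * u k ord0 = 0 by [].
by rewrite mulf_eq0 orbb => /(_ _)/eqP; apply => i _; rewrite -expr2 sqr_ge0.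
Qed.

Lemma dotv_ge0 (R : realDomainType) n (u : 'cV[R]_n) : 0 <= dotv u u.
Proof. by apply: sumr_ge0 => k _; rewrite -expr2 sqr_ge0. Qed.

(* Neither closedness nor an interior point is needed: by induction on d, if the
   first coordinate takes both signs on C, a functional on the hyperplane where
   it vanishes is extended by the supremum of the lower bounds on its first
   coefficient; otherwise the first coordinate itself, up to sign, separates. *)
Lemma proper_separation (R : realType) d (C : 'cV[R]_d -> Prop) :
  (forall u v, C u -> C v -> C (u + v)) ->
  (forall a u, 0 < a -> C u -> C (a *: u)) ->
  ~ C 0 -> (exists u, C u) ->
  exists l, (forall u, C u -> 0 <= dotv l u) /\
            exists2 u, C u & 0 < dotv l u.
Proof.
elim: d C => [|d IHd] C CD CZ C0 [u0 Cu0].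
  by case: C0; rewrite -(flatmx0 u0).
pose ext (s : R) (v : 'cV[R]_d) : 'cV[R]_d.+1 := @col_mx R 1 d 1 s%:M v.
have extE u : exists s v, u = ext s v.
  exists (u ord0 ord0), (@dsubmx _ 1 d 1 u).
  apply: etrans (esym (@vsubmxK _ 1 d 1 u)) _; congr (@col_mx _ 1 d 1 _ _).
  apply/matrixP => i j; rewrite !ord1 !mxE eqxx mulr1n.
  by congr (u _ _); apply/val_inj.
have dot_ext s v s' v' : dotv (ext s v) (ext s' v') = s * s' + dotv v v'.
  by rewrite [LHS](@dotv_col_mx _ 1 d) dotv_scalar.
have extD s v s' v' : ext s v + ext s' v' = ext (s + s') (v + v').
  by rewrite [LHS](@add_col_mx _ 1 d) -raddfD.
have extZ a s v : a *: ext s v = ext (a * s) (a *: v).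
  by rewrite [LHS](@scale_col_mx _ 1 d) scale_scalar_mx.
have ext0 : ext 0 0 = 0 by rewrite /ext raddf0 [LHS](@col_mx0 _ 1 d).
have [[s1 [v1 [s1gt C1]]]|noP] :=
    pselect (exists s v, 0 < s /\ C (ext s v)); last first.
  have le0 s v : C (ext s v) -> s <= 0.
    by move=> Csv; rewrite leNgt; apply/negP => s0; apply: noP; exists s, v.
  have [[s1 [v1 [s1lt C1]]]|noN] :=
      pselect (exists s v, s < 0 /\ C (ext s v)).
    exists (ext (-1) 0); split=> [u|].
      have [s [v ->]] := extE u => /le0 s0.
      by rewrite dot_ext dotv0l addr0 mulN1r oppr_ge0.
    by exists (ext s1 v1); rewrite // dot_ext dotv0l addr0 mulN1r oppr_gt0.
  (* Here the first coordinate vanishes on all of [C], so [C] lives in dimension [d]. *)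
  have eq0 s v : C (ext s v) -> s = 0.
    move=> Csv; apply/le_anti; rewrite (le0 _ _ Csv) leNgt /=.
    by apply/negP => s0; apply: noN; exists s, v.
  have [||||l [lP [v Cv lv]]] := IHd (fun v => C (ext 0 v)).
  - by move=> u v Cu Cv; rewrite -[0]addr0 -extD; apply: CD.
  - by move=> a u a0 Cu; rewrite -(mulr0 a) -extZ; apply: CZ.
  - by rewrite ext0.
  - have [s [v u0E]] := extE u0; exists v.
    by move: Cu0; rewrite u0E => Csv; rewrite -(eq0 _ _ Csv).
  exists (ext 0 l); split=> [u|].
    have [s [w ->]] := extE u => Csw.
    by rewrite dot_ext mul0r add0r lP // -(eq0 _ _ Csw).
  by exists (ext 0 v) => //; rewrite dot_ext mul0r add0r.
have [[s2 [v2 [s2lt C2]]]|noN] :=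
    pselect (exists s v, s < 0 /\ C (ext s v)); last first.
  have ge0 s v : C (ext s v) -> 0 <= s.
    by move=> Csv; rewrite leNgt; apply/negP => s0; apply: noN; exists s, v.
  exists (ext 1 0); split=> [u|].
    by have [s [v ->]] := extE u => /ge0; rewrite dot_ext dotv0l addr0 mul1r.
  by exists (ext s1 v1); rewrite // dot_ext dotv0l addr0 mul1r.
(* Rescaling brings the first coordinate to 1 or -1. *)
have CP s v : 0 < s -> C (ext s v) -> C (ext 1 (s^-1 *: v)).
  move=> s0 Csv; rewrite -(mulVf (lt0r_neq0 s0)) -extZ.
  by apply: CZ => //; rewrite invr_gt0.
have CN s v : s < 0 -> C (ext s v) -> C (ext (-1) ((- s)^-1 *: v)).
  move=> s0 Csv; have s0' : 0 < - s by rewrite oppr_gt0.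
  have -> : -1 = (- s)^-1 * s.
    by rewrite invrN mulNr mulVf // lt_eqF.
  by rewrite -extZ; apply: CZ => //; rewrite invr_gt0.
have {}C1 := CP _ _ s1gt C1; have {}C2 := CN _ _ s2lt C2.
have CPN v w : C (ext 1 v) -> C (ext (-1) w) -> C (ext 0 (v + w)).
  by move=> Cv Cw; rewrite -(subrr 1) -extD; apply: CD.
have [||||l [lP [v0 Cv0 lv0]]] := IHd (fun v => C (ext 0 v)).
- by move=> u v Cu Cv; rewrite -[0]addr0 -extD; apply: CD.
- by move=> a u a0 Cu; rewrite -(mulr0 a) -extZ; apply: CZ.
- by rewrite ext0.
- by eexists; apply: (CPN _ _ C1 C2).
(* A first coefficient $\sigma$ must satisfy $\sigma\ge-\langle l,v\rangle$ whenever $(1,v)\in C$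
   and $\sigma\le\langle l,w\rangle$ whenever $(-1,w)\in C$. These are compatible because
   $(0,v+w)\in C$, where [l] is nonnegative. *)
pose low := [set - dotv l v | v in [set v | C (ext 1 v)]]%classic.
have low_ub w : C (ext (-1) w) -> ubound low (dotv l w).
  move=> Cw _ [v Cv <-]; rewrite -subr_ge0 opprK addrC -dotvDr.
  by apply: lP; apply: CPN.
have low_sup : has_sup low.
  split; first by exists (- dotv l (s1^-1 *: v1)); exists (s1^-1 *: v1).
  by eexists; apply: (low_ub _ C2).
exists (ext (sup low) l); split=> [u|]; last first.
  by exists (ext 0 v0); rewrite // dot_ext mulr0 add0r.
have [s [v ->]] := extE u => Csv; rewrite dot_ext.
case: (ltrgt0P s) => s0; last 1 first.
- by rewrite s0 mulr0 add0r lP // -s0.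
- have /CP/(_ Csv) Cv := s0.
  have : - dotv l (s^-1 *: v) <= sup low.
    by apply: sup_upper_bound => //; exists (s^-1 *: v).
  rewrite dotvZr -mulrN ler_pdivrMl // => h.
  by rewrite -subr_ge0 opprK mulrC in h.
- have /CN/(_ Csv) Cv := s0.
  have : sup low <= dotv l ((- s)^-1 *: v).
    by apply: ge_sup => //; [case: low_sup | apply: low_ub].
  rewrite dotvZr ler_pdivlMl ?oppr_gt0 // mulNr => h.
  by rewrite -subr_ge0 opprK addrC mulrC in h.
Qed.

(** * The Lorentz cone as a quadratic cone: self-duality, orthogonal pairs, interior points *)

Section LorentzCone.
Variable R : rcfType.
Implicit Types (n : nat) (a : R).

Local Notation J u := (Jmx R _ *m u).

(** The Minkowski form $u_0v_0-\sum_{k\ge1}u_kv_k$. *)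
Definition lform n (u v : 'cV[R]_n) : R := dotv u (J v).

(* A common description of all the blocks: for n = 1 this is the half-line. *)
Definition lorentz n (u : 'cV[R]_n) : Prop :=
  (forall k : 'I_n, k = 0%N :> nat -> 0 <= u k ord0) /\ 0 <= lform u u.

Lemma lorentzP n (u : 'cV[R]_n.+1) :
  lorentz u <-> 0 <= u ord0 ord0 /\ 0 <= lform u u.
Proof.
split=> -[u0 uf]; split=> //; first exact: u0.
by move=> k k0; rewrite (_ : k = ord0) //; apply/val_inj.
Qed.

(** Writing $J=2e_0e_0^T-I$ turns identities in [lform] into ring identities in [dotv] and first
    coordinates. *)
Lemma Jmx_mul n (u : 'cV[R]_n.+1) :
  J u = (2 * u ord0 ord0) *: delta_mx ord0 ord0 - u.
Proof.
rewrite mul_diag_mx; apply/matrixP => k o; rewrite (ord1 o) !mxE.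
have [k0|k0] := eqVneq (k : nat) 0%N.
  by have -> : k = ord0 by [apply/val_inj]; rewrite eqxx /=; ring.
have -> : (k == ord0) = false by apply/negbTE.
by rewrite /=; ring.
Qed.

Lemma dotv_delta n (u : 'cV[R]_n.+1) k : dotv u (delta_mx k ord0) = u k ord0.
Proof.
rewrite /dotv (bigD1 k) //= big1 => [|i ik]; rewrite !mxE ?eqxx ?mulr1 ?addr0 //.
by rewrite (negbTE ik) mulr0.
Qed.

Lemma lformE n (u v : 'cV[R]_n.+1) :
  lform u v = 2 * u ord0 ord0 * v ord0 ord0 - dotv u v.
Proof. by rewrite /lform Jmx_mul dotvBr dotvZr dotv_delta; ring. Qed.

Lemma lformC n (u v : 'cV[R]_n.+1) : lform u v = lform v u.
Proof. by rewrite !lformE dotvC; ring. Qed.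

Lemma lformDl n (u v w : 'cV[R]_n) : lform (u + v) w = lform u w + lform v w.
Proof. exact: dotvDl. Qed.

Lemma lformDr n (u v w : 'cV[R]_n) : lform u (v + w) = lform u v + lform u w.
Proof. by rewrite /lform mulmxDr dotvDr. Qed.

Lemma lformBl n (u v w : 'cV[R]_n) : lform (u - v) w = lform u w - lform v w.
Proof. exact: dotvBl. Qed.

Lemma lformBr n (u v w : 'cV[R]_n) : lform u (v - w) = lform u v - lform u w.
Proof. by rewrite /lform mulmxBr dotvBr. Qed.

Lemma lformZl n a (u v : 'cV[R]_n) : lform (a *: u) v = a * lform u v.
Proof. exact: dotvZl. Qed.

Lemma lformZr n a (u v : 'cV[R]_n) : lform u (a *: v) = a * lform u v.
Proof. by rewrite /lform -scalemxAr dotvZr. Qed.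

Lemma lform0 n : lform (0 : 'cV[R]_n) 0 = 0.
Proof. exact: dotv0l. Qed.

Lemma JmxK n (u : 'cV[R]_n.+1) : J (J u) = u.
Proof.
by apply/matrixP => k o; rewrite !mul_diag_mx !mxE; case: ifP => _; ring.
Qed.

Lemma dotv_Jmx n (u v : 'cV[R]_n.+1) : dotv (J u) v = lform u v.
Proof. by rewrite /lform dotv_mulmxl /Jmx tr_diag_mx. Qed.

Lemma lform_Jmx n (u v : 'cV[R]_n.+1) : lform u (J v) = dotv u v.
Proof. by rewrite /lform JmxK. Qed.

Lemma Jmx0 n (u : 'cV[R]_n.+1) : (J u) ord0 ord0 = u ord0 ord0.
Proof. by rewrite Jmx_mul !mxE !eqxx /=; ring. Qed.

Lemma lorentz_Jmx n (u : 'cV[R]_n.+1) : lorentz u -> lorentz (J u).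
Proof. by rewrite !lorentzP Jmx0 lform_Jmx dotv_Jmx => -[]. Qed.

Lemma lorentz0 n : lorentz (0 : 'cV[R]_n).
Proof. by split=> [k _|]; rewrite ?mxE // lform0. Qed.

Lemma lorentzZ n a (u : 'cV[R]_n) : 0 <= a -> lorentz u -> lorentz (a *: u).
Proof.
move=> a0 [u0 uf]; split=> [k /u0 k0|]; first by rewrite mxE mulr_ge0.
by rewrite lformZl lformZr !mulr_ge0.
Qed.

Lemma lorentz_eq0 n (u : 'cV[R]_n.+1) : lorentz u -> u ord0 ord0 = 0 -> u = 0.
Proof.
move=> /lorentzP[_ uf] u0; move: uf; rewrite lformE u0 mulr0 sub0r oppr_ge0.
by move=> uu; apply/dotv_eq0/le_anti; rewrite uu dotv_ge0.
Qed.

Lemma lorentz_gt0 n (u : 'cV[R]_n.+1) :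
  lorentz u -> u != 0 -> 0 < u ord0 ord0.
Proof.
move=> uL un0; have /lorentzP[u0 _] := uL; rewrite lt0r u0 andbT.
by apply: contra un0 => /eqP/(lorentz_eq0 uL) ->.
Qed.

(** A form of Cauchy-Schwarz with explicit remainder: for [u], [v] in the cone all terms on the
    right are nonnegative. It yields both self-duality and its equality case. *)
Lemma lorentz_dot_identity n (u v : 'cV[R]_n.+1) :
  let w := u ord0 ord0 *: v - v ord0 ord0 *: J u in
  2 * (u ord0 ord0 * v ord0 ord0) * dotv u v =
  dotv w w + u ord0 ord0 ^+ 2 * lform v v + v ord0 ord0 ^+ 2 * lform u u.
Proof.
rewrite /= dotvBl !dotvBr !dotvZl !dotvZr (dotvC v (J u)) !dotv_Jmx lform_Jmx.
by rewrite !lformE; ring.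
Qed.

Lemma lorentz_dot_ge0 n (u v : 'cV[R]_n.+1) :
  lorentz u -> lorentz v -> 0 <= dotv u v.
Proof.
move=> uL vL; have [->|un0] := eqVneq u 0; first by rewrite dotv0l.
have [->|vn0] := eqVneq v 0; first by rewrite dotv0r.
have u0 := lorentz_gt0 uL un0; have v0 := lorentz_gt0 vL vn0.
rewrite -(@pmulr_rge0 _ (2 * (u ord0 ord0 * v ord0 ord0))) ?mulr_gt0 //.
have /lorentzP[_ uf] := uL; have /lorentzP[_ vf] := vL.
by rewrite lorentz_dot_identity /= !addr_ge0 ?dotv_ge0 // mulr_ge0 ?sqr_ge0.
Qed.

(** When $\langle u,v\rangle=0$ every term on the right of [lorentz_dot_identity] vanishes, in
    particular the square of $u_0v-v_0Ju$. *)
Lemma lorentz_orth n (u v : 'cV[R]_n.+1) :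
  lorentz u -> lorentz v -> dotv u v = 0 -> u != 0 ->
  v = (v ord0 ord0 / u ord0 ord0) *: J u.
Proof.
move=> uL vL uv0 un0; have u0 := lorentz_gt0 uL un0.
have /lorentzP[_ uf] := uL; have /lorentzP[_ vf] := vL.
have := lorentz_dot_identity u v; rewrite uv0 mulr0 /=; set w := _ - _ => /esym.
have uv_ge0 : 0 <= u ord0 ord0 ^+ 2 * lform v v + v ord0 ord0 ^+ 2 * lform u u.
  by rewrite addr_ge0 // mulr_ge0 ?sqr_ge0.
rewrite -addrA => /eqP; rewrite paddr_eq0 ?dotv_ge0 // => /andP[/eqP/dotv_eq0 w0 _].
move/eqP: w0; rewrite subr_eq0 => /eqP w0; rewrite mulrC -scalerA -w0 scalerA.
by rewrite mulVf ?scale1r // gt_eqF.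
Qed.

(** The cross term [lform u v] is the inner product of the cone elements $u$ and $Jv$. *)
Lemma lorentzD n (u v : 'cV[R]_n.+1) :
  lorentz u -> lorentz v -> lorentz (u + v).
Proof.
move=> uL vL; have /lorentzP[u0 uf] := uL; have /lorentzP[v0 vf] := vL.
apply/lorentzP; rewrite mxE addr_ge0 //; split=> //.
rewrite lformDl !lformDr.
have uv : 0 <= lform u v := lorentz_dot_ge0 uL (lorentz_Jmx vL).
by rewrite (lformC v u) !addr_ge0.
Qed.

Lemma lform_delta n (u : 'cV[R]_n.+1) : lform u (delta_mx ord0 ord0) = u ord0 ord0.
Proof. by rewrite lformE dotv_delta mxE !eqxx /=; ring. Qed.

Lemma lorentz_delta n : lorentz (delta_mx ord0 ord0 : 'cV[R]_n.+1).
Proof. by apply/lorentzP; rewrite lform_delta mxE !eqxx /= ler01. Qed.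

(** The vector $e_0$ is interior to the cone, so a large multiple of it absorbs [z]. *)
Lemma lorentz_spans n (z : 'cV[R]_n.+1) :
  exists p p', [/\ lorentz p, lorentz p' & z = p - p'].
Proof.
(* This [s] ensures $s\ge|f|$ and $s+2z_0\ge1$, so that the form at $z+se_0$, which is
   $f+s(s+2z_0)$, is at least $f+|f|$. *)
pose f := lform z z; pose s : R := 2 * `|z ord0 ord0| + `|f| + 1.
have s0 : 0 <= s by rewrite !addr_ge0 ?mulr_ge0.
exists (z + s *: delta_mx ord0 ord0), (s *: delta_mx ord0 ord0); split.
- apply/lorentzP; rewrite !mxE eqxx /= mulr1.
  have zl : - `|z ord0 ord0| <= z ord0 ord0 by rewrite lerNl -normrN ler_norm.
  have fl : - `|f| <= f by rewrite lerNl -normrN ler_norm.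
  have z0 := normr_ge0 (z ord0 ord0); have f0 := normr_ge0 f.
  split; first by rewrite /s; lra.
  have -> : lform (z + s *: delta_mx ord0 ord0) (z + s *: delta_mx ord0 ord0)
      = f + s * (s + 2 * z ord0 ord0).
    rewrite lformDl !lformDr !lformZl !lformZr !lform_delta.
    by rewrite lformC lform_delta mxE eqxx /= -/f; ring.
  have h1 : `|f| + 1 <= s + 2 * z ord0 ord0 by rewrite /s; lra.
  have h2 : `|f| <= s by rewrite /s; lra.
  have : `|f| * 1 <= s * (s + 2 * z ord0 ord0) by rewrite ler_pM //; lra.
  lra.
- by apply: lorentzZ => //; apply: lorentz_delta.
- by rewrite addrK.
Qed.

Lemma lorentz_dual n (y : 'cV[R]_n.+1) :
  (forall x, lorentz x -> 0 <= dotv y x) -> lorentz y.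
Proof.
move=> yL; have y0 := yL _ (lorentz_delta n); rewrite dotv_delta in y0.
apply/lorentzP; split=> //; set t := y ord0 ord0 in y0 *.
have N0 : 0 <= dotv y y - t ^+ 2.
  rewrite /dotv big_ord_recl -expr2 addrC addKr sumr_ge0 // => k _.
  by rewrite -expr2 sqr_ge0.
pose N := Num.sqrt (dotv y y - t ^+ 2).
have NE : N ^+ 2 = dotv y y - t ^+ 2 by rewrite sqr_sqrtr.
have Nge0 : 0 <= N by apply: sqrtr_ge0.
(* With $y=(t,\bar y)$ and $N=\|\bar y\|$, the test vector is the boundary point $(N,-\bar y)$,
   whose product with $y$ is $N(t-N)$. *)
have /yL : lorentz ((N + t) *: delta_mx ord0 ord0 - y).
  apply/lorentzP; rewrite !mxE !eqxx /= mulr1 -/t addrK; split=> //.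
  rewrite lformBl !lformBr !lformZl !lformZr !lform_delta.
  rewrite (lformC _ y) lform_delta mxE eqxx lformE -/t /=.
  have -> : dotv y y = N ^+ 2 + t ^+ 2 by rewrite NE subrK.
  rewrite (_ : (_ - _) - _ = 0) //; ring.
rewrite dotvBr dotvZr dotv_delta lformE -/t.
have -> : dotv y y = N ^+ 2 + t ^+ 2 by rewrite NE subrK.
(* The conclusion follows from $t^2-N^2=(t-N)^2+2N(t-N)$. *)
have := sqr_ge0 (t - N); nra.
Qed.

Lemma lorentz_order_unit n (q z : 'cV[R]_n.+1) :
  lorentz q -> lform q q != 0 -> lorentz z ->
  exists2 a, 0 <= a & lorentz (a *: q - z).
Proof.
move=> qL qn0 zL; have /lorentzP[q0 qf] := qL; have /lorentzP[z0 zf] := zL.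
have qf0 : 0 < lform q q by rewrite lt0r qn0.
have {}q0 : 0 < q ord0 ord0.
  apply: lorentz_gt0 => //; apply: contra qn0 => /eqP ->.
  by rewrite lform0.
have qz0 : 0 <= lform q z := lorentz_dot_ge0 qL (lorentz_Jmx zL).
(* The multiple [a1] makes the first coordinate of $a_1q-z$ vanish, and [a2] cancels the cross term
   in the form; their sum serves both purposes. *)
pose a1 := z ord0 ord0 / q ord0 ord0; pose a2 := 2 * lform q z / lform q q.
have a1E : a1 * q ord0 ord0 = z ord0 ord0 by rewrite /a1 divfK ?gt_eqF.
have a2E : a2 * lform q q = 2 * lform q z by rewrite /a2 divfK ?gt_eqF.
have a1_ge0 : 0 <= a1 by rewrite divr_ge0 // ltW.
have a2_ge0 : 0 <= a2 by rewrite divr_ge0 ?mulr_ge0 // ltW.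
exists (a1 + a2); first exact: addr_ge0.
apply/lorentzP; rewrite !mxE; split.
  by rewrite mulrDl a1E addrC addKr mulr_ge0 // ltW.
rewrite lformBl !lformBr !lformZl !lformZr (lformC z q).
have -> : (a1 + a2) * ((a1 + a2) * lform q q) - (a1 + a2) * lform q z -
  ((a1 + a2) * lform q z - lform z z) =
  (a1 + a2) * (a1 * lform q q + (a2 * lform q q - 2 * lform q z)) + lform z z by ring.
by rewrite a2E subrr addr0 addr_ge0 // mulr_ge0 ?addr_ge0 // mulr_ge0 // ltW.
Qed.

(** Stated as an equality of predicates so that it rewrites under the quantifiers of [tan']. On a
    scalar block the form is $u_0^2$, and only the sign condition remains. *)
Lemma in_blockE B : in_block B = @lorentz (bdim B).
Proof.
apply/funext => u; apply/propext; case: B u => [|k] u; rewrite lorentzP.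
  split=> [u0|[]//]; split=> //.
  rewrite lformE /dotv big_ord1.
  by have := sqr_ge0 (u ord0 ord0); rewrite expr2; lra.
have E : lform u u = u ord0 ord0 ^+ 2 - \sum_(a < k.+1) u (lift ord0 a) ord0 ^+ 2.
  rewrite lformE /dotv big_ord_recl (eq_bigr _ (fun i _ => esym (expr2 _))).
  by rewrite -expr2; ring.
have S0 : 0 <= \sum_(a < k.+1) u (lift ord0 a) ord0 ^+ 2.
  by apply: sumr_ge0 => a _; rewrite sqr_ge0.
rewrite E subr_ge0; split=> [/= h|[u0 h] /=].
  have u0 : 0 <= u ord0 ord0 by apply: le_trans h; rewrite sqrtr_ge0.
  by split=> //; rewrite -(sqr_sqrtr S0) ler_sqr ?nnegrE ?sqrtr_ge0.
by rewrite -(ger0_norm u0) -sqrtr_sqr ler_sqrt // sqr_ge0.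
Qed.

End LorentzCone.

(** * Tangent vectors and faces within a single block *)

Section Tangent.
Variable R : rcfType.
Implicit Types (n : nat) (a : R).

Local Notation J u := (Jmx R _ *m u).

Definition orth_face n (q z : 'cV[R]_n) : Prop :=
  forall x, lorentz x -> dotv q x = 0 -> dotv z x = 0.

Definition tan_lorentz n (u z : 'cV[R]_n) : Prop :=
  exists w, exists vp vm : rmap n -> 'cV[R]_n,
  [/\ lorentz w, forall r, lorentz (vp r) /\ lorentz (vm r),
      u = w + \sum_r (vp r + vm r)
    & z = \sum_r rmap_mx R r *m (vp r - vm r)].

(** Letting [a] vary makes the admissible [z] a linear subspace, so membership can be checked on
    spanning vectors. *)
Definition tan_scaled n (q z : 'cV[R]_n) : Prop :=
  exists2 a, 0 <= a & tan_lorentz (a *: q) z.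

Lemma orth_face0 n (z : 'cV[R]_n.+1) : orth_face 0 z -> z = 0.
Proof.
move=> h; have [p [p' [pL p'L zE]]] := lorentz_spans z.
by apply: dotv_eq0; rewrite {2}zE dotvBr !h ?dotv0l ?subrr.
Qed.

Lemma dotv_skew n (M : 'M[R]_n) (p : 'cV[R]_n) :
  M^T = - M -> dotv (M *m p) p = 0.
Proof.
move=> MT; have : dotv (M *m p) p = - dotv (M *m p) p.
  by rewrite {1}dotv_mulmxl MT mulNmx dotvNr dotvC.
lra.
Qed.

(** For $v\ne0$, [x] is a multiple of $Jv$, and $\langle S_{ab}Jv,Jv\rangle=0$ because $S_{ab}$ is
    skew. *)
Lemma rmap_orth n (r : rmap n.+1) (v x : 'cV[R]_n.+1) :
  lorentz v -> lorentz x -> dotv v x = 0 -> dotv (rmap_mx R r *m v) x = 0.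
Proof.
move=> vL xL vx; case: r => [p|]; last by rewrite mul1mx.
have [->|vn0] := eqVneq v 0; first by rewrite mulmx0 dotv0l.
rewrite (lorentz_orth vL xL vx vn0) dotvZr -mulmxA dotv_skew ?mulr0 //.
by rewrite /Smx linearB /= !trmx_delta opprB.
Qed.

(** If $\langle u,x\rangle=0$, the nonnegative products of [x] with the summands of [u] all vanish,
    and [rmap_orth] applies to each summand of [z]. *)
Lemma tan_orth_face n (u z : 'cV[R]_n.+1) : tan_lorentz u z -> orth_face u z.
Proof.
move=> [w [vp [vm [wL vL -> ->]]]] x xL; rewrite dotvDl !dotv_suml.
have v0 r : 0 <= dotv (vp r + vm r) x.
  by have [pL mL] := vL r; apply: lorentz_dot_ge0 => //; apply: lorentzD.
move/eqP; rewrite paddr_eq0 ?lorentz_dot_ge0 ?sumr_ge0 // => /andP[_].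
rewrite psumr_eq0 // => /allP vx; apply: big1 => r _; have [pL mL] := vL r.
have := vx r (mem_index_enum r); rewrite /= dotvDl.
rewrite paddr_eq0 ?lorentz_dot_ge0 // => /andP[/eqP p0 /eqP m0].
by rewrite mulmxBr dotvBl !rmap_orth // subrr.
Qed.

Lemma tan_lorentzZ n a (u z : 'cV[R]_n) :
  0 <= a -> tan_lorentz u z -> tan_lorentz (a *: u) (a *: z).
Proof.
move=> a0 [w [vp [vm [wL vL -> ->]]]].
exists (a *: w), (fun r => a *: vp r), (fun r => a *: vm r); split.
- exact: lorentzZ.
- by move=> r; have [pL mL] := vL r; split; apply: lorentzZ.
- rewrite scalerDr scaler_sumr; congr (_ + _).
  by apply: eq_bigr => r _; rewrite scalerDr.
- by rewrite scaler_sumr; apply: eq_bigr => r _; rewrite -scalerBr -scalemxAr.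
Qed.

(** The surplus $(a'-a)q$ goes into the slack [w]. *)
Lemma tan_lorentz_mono n a a' (q z : 'cV[R]_n.+1) :
  lorentz q -> a <= a' -> tan_lorentz (a *: q) z -> tan_lorentz (a' *: q) z.
Proof.
move=> qL aa' [w [vp [vm [wL vL uE zE]]]].
exists (w + (a' - a) *: q), vp, vm; split=> //.
  by apply: lorentzD => //; apply: lorentzZ; rewrite ?subr_ge0.
by rewrite addrAC -uE -scalerDl addrC subrK.
Qed.

Lemma tan_scaledD n (q z z' : 'cV[R]_n.+1) :
  tan_scaled q z -> tan_scaled q z' -> tan_scaled q (z + z').
Proof.
move=> [a a0 [w [vp [vm [wL vL uE zE]]]]].
move=> [a' a'0 [w' [vp' [vm' [w'L v'L u'E z'E]]]]].
exists (a + a'); first exact: addr_ge0.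
exists (w + w'), (fun r => vp r + vp' r), (fun r => vm r + vm' r); split.
- exact: lorentzD.
- by move=> r; have [? ?] := vL r; have [? ?] := v'L r; split; apply: lorentzD.
- rewrite scalerDl uE u'E addrACA -big_split /=; congr (_ + _).
  by apply: eq_bigr => r _; rewrite addrACA.
- rewrite zE z'E -big_split /=; apply: eq_bigr => r _.
  by rewrite -mulmxDr opprD addrACA.
Qed.

Lemma tan_scaled0 n (q : 'cV[R]_n) : tan_scaled q 0.
Proof.
exists 0 => //; exists 0, (fun=> 0), (fun=> 0); split.
- exact: lorentz0.
- by move=> r; split; apply: lorentz0.
- by rewrite scale0r big1 ?addr0 // => r _; rewrite addr0.
- by rewrite big1 // => r _; rewrite subrr mulmx0.
Qed.

Lemma tan_scaledZ n a (q z : 'cV[R]_n) :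
  tan_scaled q z -> tan_scaled q (a *: z).
Proof.
have pos c y : 0 <= c -> tan_scaled q y -> tan_scaled q (c *: y).
  move=> c0 [a' a'0 t]; exists (c * a'); first exact: mulr_ge0.
  by rewrite -scalerA; apply: tan_lorentzZ.
(* Exchanging [vp] and [vm] changes the sign of [z] and preserves the decomposition of [u]. *)
have opp y : tan_scaled q y -> tan_scaled q (- y).
  move=> [a' a'0 [w [vp [vm [wL vL uE zE]]]]]; exists a' => //.
  exists w, vm, vp; split=> //.
  - by move=> r; have [] := vL r.
  - by rewrite uE; congr (_ + _); apply: eq_bigr => r _; rewrite addrC.
  - by rewrite zE -sumrN; apply: eq_bigr => r _; rewrite -mulmxN opprB.
move=> t; have [a0|a0] := leP 0 a; first exact: pos.
by rewrite -[a]opprK scaleNr; apply/opp/pos => //; rewrite oppr_ge0 ltW.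
Qed.

Lemma tan_scaled_sum n (I : finType) (q : 'cV[R]_n.+1) (F : I -> 'cV[R]_n.+1) :
  (forall i, tan_scaled q (F i)) -> tan_scaled q (\sum_i F i).
Proof.
move=> FL; elim/big_ind: _ => // [|u v]; first exact: tan_scaled0.
exact: tan_scaledD.
Qed.

Lemma tan_scaled_rmap n a (r : rmap n) (q v : 'cV[R]_n) :
  0 <= a -> lorentz v -> lorentz (a *: q - v) ->
  tan_scaled q (rmap_mx R r *m v).
Proof.
move=> a0 vL wL; exists a => //.
exists (a *: q - v), (fun r' => if r' == r then v else 0), (fun=> 0); split=> //.
- by move=> r'; split; last exact: lorentz0; case: ifP => _ //; apply: lorentz0.
- rewrite (bigD1 r) //= eqxx big1 => [|r' /negbTE ->]; last by rewrite addr0.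
  by rewrite !addr0 subrK.
- rewrite (bigD1 r) //= eqxx big1 => [|r' /negbTE ->].
    by rewrite subr0 addr0.
  by rewrite subr0 mulmx0.
Qed.

(* For q on the boundary, q^perp meets the cone in the ray of p = J q, and p^perp
   is spanned by the vectors S_0b p. *)
Lemma skew_span n (p z : 'cV[R]_n.+1) :
  p ord0 ord0 != 0 -> dotv z p = 0 ->
  z = \sum_(b < n) (- (z (lift ord0 b) ord0 / p ord0 ord0)) *:
        (Smx R ord0 (lift ord0 b) *m p).
Proof.
move=> p0 zp; have Sp b : Smx R ord0 (lift ord0 b) *m p =
    p (lift ord0 b) ord0 *: delta_mx ord0 ord0 -
    p ord0 ord0 *: delta_mx (lift ord0 b) ord0.
  have E (i j : 'I_n.+1) :
      delta_mx i j *m p = p j ord0 *: delta_mx i ord0 :> 'cV[R]_n.+1.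
    apply/matrixP => k o; rewrite (ord1 o) !mxE (bigD1 j) //= big1 => [|l lj].
      by rewrite !mxE !eqxx andbT addr0 mulrC.
    by rewrite !mxE (negbTE lj) andbF mul0r.
  by rewrite mulmxBl !E.
apply/matrixP => k o; rewrite (ord1 o) summxE.
case: (unliftP ord0 k) => [b|] ->.
  rewrite (bigD1 b) //= big1 => [|c cb]; rewrite Sp !mxE.
    by rewrite !eqxx addr0 /= mulr0 mulr1 sub0r mulrNN divfK.
  have -> : (lift ord0 b == lift ord0 c) = false.
    by apply/negbTE; rewrite (inj_eq lift_inj) eq_sym.
  by rewrite /= !mulr0 subrr mulr0.
rewrite (eq_bigr (fun b => - (p ord0 ord0)^-1 *
    (z (lift ord0 b) ord0 * p (lift ord0 b) ord0))); last first.
  by move=> b _; rewrite Sp !mxE !eqxx /= mulr1 mulr0 subr0; ring.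
rewrite -mulr_sumr; move: zp; rewrite /dotv big_ord_recl => /eqP.
rewrite addr_eq0 => /eqP zp0; rewrite -[\sum_(i < n) _]opprK -zp0.
by rewrite mulrNN mulrC mulfK.
Qed.

(** For $q=0$ the face spans the space and $z=0$. An interior $q$ dominates every cone element up to
    scaling, so the identity map alone suffices. On the boundary the maps $S_{0b}J$ applied to $q$
    suffice. *)
Lemma orth_face_tan_scaled n (q z : 'cV[R]_n.+1) :
  lorentz q -> orth_face q z -> tan_scaled q z.
Proof.
move=> qL qz; have [q0|qn0] := eqVneq q 0.
  by rewrite q0 in qz; rewrite (orth_face0 qz); apply: tan_scaled0.
have [qf|qf] := eqVneq (lform q q) 0; last first.
  have [p [p' [pL p'L ->]]] := lorentz_spans z.
  rewrite -scaleN1r; apply: tan_scaledD; last apply: tan_scaledZ.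
    have [a a0 aL] := lorentz_order_unit qL qf pL.
    by rewrite -[p]mul1mx; apply: (@tan_scaled_rmap _ a None).
  have [a a0 aL] := lorentz_order_unit qL qf p'L.
  by rewrite -[p']mul1mx; apply: (@tan_scaled_rmap _ a None).
have zp : dotv z (J q) = 0 by apply: qz; [apply: lorentz_Jmx | exact: qf].
have p0 : (J q) ord0 ord0 != 0 by rewrite Jmx0 gt_eqF // lorentz_gt0.
rewrite (skew_span p0 zp); apply: tan_scaled_sum => b; apply: tan_scaledZ.
pose r : rmap n.+1 := Some (exist (fun p : 'I_n.+1 * 'I_n.+1 => (p.1 < p.2)%N)
  (ord0, lift ord0 b) isT).
rewrite mulmxA; apply: (@tan_scaled_rmap _ 1 r q q) => //.
by rewrite scale1r subrr; apply: lorentz0.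
Qed.

(** For [q] in the cone, the rank of the face $L\cap q^\perp$: the whole cone when $q=0$, a ray when
    $q\ne0$ is on the boundary (rank 1), the origin when $q$ is interior (rank 0). *)
Definition lorentz_rank n (q : 'cV[R]_n) : nat :=
  if q == 0 then minn n 2 else lform q q == 0.

(* The dual cone of the face {x in L : <q, x> = 0} is L + face^perp. *)
Lemma face_dual_decomp n (q y : 'cV[R]_n.+1) :
  lorentz q -> (forall x, lorentz x -> dotv q x = 0 -> 0 <= dotv y x) ->
  exists q', [/\ lorentz q', orth_face q (y - q'),
    (lorentz_rank (q + q')%R <= lorentz_rank q)%N
    & (lorentz_rank (q + q')%R < lorentz_rank q)%N \/ orth_face q y].
Proof.
move=> qL yF; have [q0|qn0] := eqVneq q 0.
  have yL : lorentz y.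
    by apply: lorentz_dual => x xL; apply: yF; rewrite // q0 dotv0l.
  exists y; rewrite q0 add0r subrr; split=> //; rewrite /lorentz_rank ?eqxx.
  - have [_|_] := eqVneq y 0; first exact: leqnn.
    case: n q y qL yF q0 yL => [|n] *; by case: (_ == _).
  - have [->|yn0] := eqVneq y 0; first by right=> x _ _; rewrite dotv0l.
    (* In dimension at least 2 the rank drops from 2 to at most 1. In dimension 1 it must drop from
       1 to 0, that is, the nonzero [y] must be interior. *)
    left; case: n q y qL yF q0 yL yn0 => [|n] q y _ _ _ yL yn0; last first.
      by case: (_ == _).
    suff -> : (lform y y == 0) = false by [].
    apply/gt_eqF; rewrite lformE /dotv big_ord1.
    have := lorentz_gt0 yL yn0; nra.
have trivial : orth_face q y -> exists q', [/\ lorentz q', orth_face q (y - q'),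
    (lorentz_rank (q + q')%R <= lorentz_rank q)%N
    & (lorentz_rank (q + q')%R < lorentz_rank q)%N \/ orth_face q y].
  move=> qy; exists 0; rewrite subr0 addr0; split=> //; first exact: lorentz0.
  by right.
have [qf|qf] := eqVneq (lform q q) 0; last first.
  apply: trivial => x xL qx; have := lorentz_orth qL xL qx qn0.
  set k := _ / _ => xE; move: qx; rewrite xE dotvZr => /eqP; rewrite mulf_eq0 orbC.
  by rewrite -[dotv _ _]/(lform q q) (negbTE qf) /= => /eqP ->; rewrite scale0r dotv0r.
have JL := lorentz_Jmx qL; have q0 := lorentz_gt0 qL qn0.
have b0 : 0 <= dotv y (J q) by apply: yF.
have [b_eq0|bn0] := eqVneq (dotv y (J q)) 0.
  apply: trivial => x xL qx.
  by rewrite (lorentz_orth qL xL qx qn0) dotvZr b_eq0 mulr0.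
have qq : 0 < dotv q q.
  by rewrite lt0r dotv_ge0 andbT; apply: contra qn0 => /eqP/dotv_eq0 ->.
(* The face is the ray of $Jq$, and $\langle Jq,Jq\rangle=\langle q,q\rangle$, so $y-gJq$ is
   orthogonal to it. Since $g>0$, the point $q+gJq$ is interior. *)
pose g := dotv y (J q) / dotv q q.
have g0 : 0 < g by rewrite divr_gt0 // lt0r bn0.
have qgf : 0 < lform (q + g *: J q) (q + g *: J q).
  rewrite lformDl !lformDr !lformZl !lformZr qf lform_Jmx (lformC (J q)) !lform_Jmx.
  by rewrite dotv_Jmx qf !mulr0 addr0 add0r -mulrDl !mulr_gt0 ?addr_gt0.
have rk : (lorentz_rank (q + g *: J q)%R < lorentz_rank q)%N.
  rewrite /lorentz_rank (negbTE qn0) qf eqxx.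
  have -> : (q + g *: J q == 0) = false.
    by apply/negbTE; apply: contraTneq qgf => ->; rewrite lform0 ltxx.
  by rewrite gt_eqF.
exists (g *: J q); split; [by apply: lorentzZ; rewrite // ltW | | exact: ltnW |].
  move=> x xL qx; rewrite (lorentz_orth qL xL qx qn0) dotvZr dotvBl dotvZl.
  by rewrite dotv_Jmx lform_Jmx /g divfK ?gt_eqF // subrr mulr0.
by left.
Qed.

End Tangent.

(** * Transfer to blocks: case analysis on [B] exhibits [bdim B] as a successor *)

Section Blocks.
Variable R : rcfType.
Implicit Types (B : block) (a : R).

Lemma block_lorentzD B (u v : 'cV[R]_(bdim B)) :
  lorentz u -> lorentz v -> lorentz (u + v).
Proof. by case: B u v => [|k] u v; apply: lorentzD. Qed.

Lemma block_dot_ge0 B (u v : 'cV[R]_(bdim B)) :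
  lorentz u -> lorentz v -> 0 <= dotv u v.
Proof. by case: B u v => [|k] u v; apply: lorentz_dot_ge0. Qed.

Lemma block_orth_face0 B (z : 'cV[R]_(bdim B)) : orth_face 0 z -> z = 0.
Proof. by case: B z => [|k] z; apply: orth_face0. Qed.

Lemma block_tan_orth_face B (u z : 'cV[R]_(bdim B)) :
  tan_lorentz u z -> orth_face u z.
Proof. by case: B u z => [|k] u z; apply: tan_orth_face. Qed.

Lemma block_tan_mono B a a' (q z : 'cV[R]_(bdim B)) :
  lorentz q -> a <= a' -> tan_lorentz (a *: q) z -> tan_lorentz (a' *: q) z.
Proof. by case: B q z => [|k] q z; apply: tan_lorentz_mono. Qed.

Lemma block_orth_face_tan_scaled B (q z : 'cV[R]_(bdim B)) :
  lorentz q -> orth_face q z -> tan_scaled q z.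
Proof. by case: B q z => [|k] q z; apply: orth_face_tan_scaled. Qed.

Lemma block_face_dual_decomp B (q y : 'cV[R]_(bdim B)) :
  lorentz q -> (forall x, lorentz x -> dotv q x = 0 -> 0 <= dotv y x) ->
  exists q', [/\ lorentz q', orth_face q (y - q'),
    (lorentz_rank (q + q')%R <= lorentz_rank q)%N
    & (lorentz_rank (q + q')%R < lorentz_rank q)%N \/ orth_face q y].
Proof. by case: B q y => [|k] q y; apply: face_dual_decomp. Qed.

End Blocks.

(** * The product cone: faces, tangents and ranks block by block *)

Section Cone.
Variables (R : rcfType) (nu : nat) (K : 'I_nu -> block).
Implicit Types u q x y z : 'cV[R]_(cdim K).

Lemma in_coneE x : in_cone K x <-> forall i, lorentz (submxcol x i).
Proof. by split=> xK i; have := xK i; rewrite in_blockE. Qed.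

Lemma tan'E u z :
  tan' K u z <-> forall i, tan_lorentz (submxcol u i) (submxcol z i).
Proof. by split=> t i; have := t i; rewrite in_blockE. Qed.

Lemma submxcolZ a x i : submxcol (a *: x) i = a *: submxcol x i.
Proof. by apply/matrixP => k o; rewrite !mxE. Qed.

Lemma in_cone0 : in_cone K (0 : 'cV[R]_(cdim K)).
Proof. by apply/in_coneE => i; rewrite submxcol0; apply: lorentz0. Qed.

Lemma in_coneD x y : in_cone K x -> in_cone K y -> in_cone K (x + y).
Proof.
move=> /in_coneE xK /in_coneE yK; apply/in_coneE => i; rewrite submxcolD.
exact: block_lorentzD.
Qed.

Lemma in_coneZ a x : 0 <= a -> in_cone K x -> in_cone K (a *: x).
Proof.
move=> a0 /in_coneE xK; apply/in_coneE => i; rewrite submxcolZ.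
exact: lorentzZ.
Qed.

Lemma in_cone_dot_ge0 x y : in_cone K x -> in_cone K y -> 0 <= dotv x y.
Proof.
move=> /in_coneE xK /in_coneE yK; rewrite dotv_submxcol sumr_ge0 // => i _.
exact: block_dot_ge0.
Qed.

Definition orth_cone_face q z : Prop :=
  forall x, in_cone K x -> dotv q x = 0 -> dotv z x = 0.

Lemma cone_orth_blocks q x i : in_cone K q -> in_cone K x ->
  dotv q x = 0 -> dotv (submxcol q i) (submxcol x i) = 0.
Proof.
move=> /in_coneE qK /in_coneE xK /eqP.
rewrite dotv_submxcol psumr_eq0 => [/allP/(_ i (mem_index_enum i))/eqP //|j _].
exact: block_dot_ge0.
Qed.

(** Padding [v] by zero blocks lets a property tested on the whole cone be tested on one block. *)
Lemma block_embedding i (v : 'cV[R]_(bdim (K i))) : lorentz v ->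
  exists2 x, in_cone K x &
    forall y, dotv y x = dotv (submxcol y i) v.
Proof.
move=> vL; pose f := dfwith (fun j => 0 : 'cV[R]_(bdim (K j))) v.
have fi : f i = v by rewrite /f dfwith_in.
have fN j : i != j -> f j = 0 by move=> ij; rewrite /f dfwith_out.
exists (\mxcol_j f j).
  apply/in_coneE => j; rewrite mxcolK; have [<-|/fN ->] := eqVneq i j.
    by rewrite fi.
  exact: lorentz0.
move=> y; rewrite dotv_submxcol (bigD1 i) //= mxcolK fi big1 ?addr0 // => j ji.
by rewrite mxcolK fN ?dotv0r // eq_sym.
Qed.

Lemma orth_cone_faceP q z : in_cone K q ->
  orth_cone_face q z <-> forall i, orth_face (submxcol q i) (submxcol z i).
Proof.
move=> qK; split=> [qz i v vL qv|qz x xK qx].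
  have [x xK xE] := block_embedding vL.
  by rewrite -xE; apply: qz; rewrite // xE.
have /in_coneE xL := xK.
rewrite dotv_submxcol big1 // => i _; apply: qz => //.
exact: cone_orth_blocks.
Qed.

Lemma tan'_orth u z : in_cone K u -> tan' K u z -> orth_cone_face u z.
Proof.
move=> uK /tan'E t; apply/orth_cone_faceP => // i.
exact: block_tan_orth_face.
Qed.

Lemma tan'0 z : tan' K 0 z -> z = 0.
Proof.
move=> /(tan'_orth in_cone0)/(orth_cone_faceP _ in_cone0) z0.
apply/mxcolP => i; rewrite submxcol0; have := z0 i; rewrite submxcol0.
exact: block_orth_face0.
Qed.

Lemma tan'Z a u z : 0 <= a -> tan' K u z -> tan' K (a *: u) (a *: z).
Proof.
move=> a0 /tan'E t; apply/tan'E => i; rewrite !submxcolZ.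
exact: tan_lorentzZ.
Qed.

(** Each block comes with its own scale; their sum dominates each of them, and [block_tan_mono]
    allows the larger scale. *)
Lemma orth_tan' q z : in_cone K q -> orth_cone_face q z ->
  exists2 a, 0 <= a & tan' K (a *: q) z.
Proof.
move=> qK /(orth_cone_faceP _ qK) qz; have /in_coneE qL := qK.
have t i : tan_scaled (submxcol q i) (submxcol z i).
  exact: block_orth_face_tan_scaled.
have tE i : exists a : R, 0 <= a /\ tan_lorentz (a *: submxcol q i) (submxcol z i).
  by have [a] := t i; exists a.
pose a i : R := projT1 (cid (tE i)).
have a0 i : 0 <= a i by have [] := projT2 (cid (tE i)).
have ta i : tan_lorentz (a i *: submxcol q i) (submxcol z i).
  by have [] := projT2 (cid (tE i)).
exists (\sum_i a i); first by apply: sumr_ge0.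
apply/tan'E => i; rewrite submxcolZ; have := ta i.
have : a i <= \sum_i a i by rewrite (bigD1 i) //= lerDl sumr_ge0.
exact: block_tan_mono.
Qed.

Definition cone_rank q : nat := \sum_i lorentz_rank (submxcol q i).

Lemma cone_rank0 : cone_rank 0 = rank K.
Proof.
apply: eq_bigr => i _; rewrite submxcol0 /lorentz_rank eqxx.
by case: (K i).
Qed.

(** The blockwise choices are assembled. No block rank increases, so one strict drop lowers the
    total; if none drops, [y] is orthogonal to the face in every block. *)
Lemma cone_face_dual_decomp q y : in_cone K q ->
  (forall x, in_cone K x -> dotv q x = 0 -> 0 <= dotv y x) ->
  exists q', [/\ in_cone K q', orth_cone_face q (y - q')
    & (cone_rank (q + q')%R < cone_rank q)%N \/ orth_cone_face q y].
Proof.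
move=> qK yF; have /in_coneE qL := qK.
have dec i : exists q' : 'cV[R]_(bdim (K i)),
    [/\ lorentz q', orth_face (submxcol q i) (submxcol y i - q'),
    (lorentz_rank (submxcol q i + q')%R <= lorentz_rank (submxcol q i))%N
    & (lorentz_rank (submxcol q i + q')%R < lorentz_rank (submxcol q i))%N \/
      orth_face (submxcol q i) (submxcol y i)].
  have : forall v, lorentz v -> dotv (submxcol q i) v = 0 ->
      0 <= dotv (submxcol y i) v.
    move=> v vL qv; have [x xK xE] := block_embedding vL.
    by rewrite -xE; apply: yF; rewrite // xE.
  exact: block_face_dual_decomp.
pose q' i := projT1 (cid (dec i)).
have q'P i := projT2 (cid (dec i)); rewrite -/(q' _) in q'P.
exists (\mxcol_i q' i); split.
- by apply/in_coneE => i; rewrite mxcolK; have [] := q'P i.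
- apply/orth_cone_faceP => // i; rewrite submxcolB mxcolK.
  by have [] := q'P i.
have [[i lt]|noi] := pselect (exists i,
    (lorentz_rank (submxcol q i + q' i)%R < lorentz_rank (submxcol q i))%N).
  left; rewrite /cone_rank (bigD1 i) //= [ltnRHS](bigD1 i) //= -addSn.
  apply: leq_add; first by rewrite submxcolD mxcolK.
  apply: leq_sum => j _; rewrite submxcolD mxcolK.
  by have [] := q'P j.
right; apply/orth_cone_faceP => // i; have [_ _ _ []//] := q'P i.
by move=> lt; case: noi; exists i.
Qed.

End Cone.

(** * Facial reduction, attainment and weak duality for the displayed dual *)

Lemma ray_ge0 (R : realFieldType) (e d : R) :
  (forall t, 0 <= t -> 0 <= t * e + d) -> 0 <= e.
Proof.
move=> h; rewrite leNgt; apply/negP => e0.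
have d0 : 0 <= d by have := h 0 (lexx _); rewrite mul0r add0r.
(* At this [t] the affine function takes the value -1. *)
have /h : 0 <= (d + 1) / - e by rewrite divr_ge0 ?addr_ge0 ?oppr_ge0 // ltW.
by rewrite invrN mulrN mulNr divfK ?lt_eqF //; lra.
Qed.

Section FacialReduction.
Variables (R : realType) (nu : nat) (K : 'I_nu -> block) (m : nat).
Variables (A : 'M[R]_(m, cdim K)) (b : 'cV[R]_m) (c : 'cV[R]_(cdim K)).
Implicit Types (q x y z : 'cV[R]_(cdim K)) (p : R).

(* Proper separation of 0 from
   {(A x - t b, <c, x> - t p + s) : x in the face, t >= 0, s > 0}.
   A separating functional (mu, sigma) with sigma > 0 is a dual optimal solution
   relative to the face; one with sigma = 0 cuts the face properly. *)
Lemma attainment_or_reduction q p :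
  in_cone K q -> (exists x, primal_feasible K A b x) ->
  (forall x, primal_feasible K A b x -> dotv q x = 0) ->
  (forall x, primal_feasible K A b x -> p <= dotv c x) ->
  (exists2 eta, p <= dotv b eta &
    forall x, in_cone K x -> dotv q x = 0 -> 0 <= dotv (c - A^T *m eta) x) \/
  (exists mu, [/\ dotv b mu = 0,
    forall x, in_cone K x -> dotv q x = 0 -> 0 <= dotv (A^T *m mu) x
    & ~ orth_cone_face q (A^T *m mu)]).
Proof.
move=> qK [x0 x0F] qF pF; have [Ax0 x0K] := x0F.
pose C (w : 'cV[R]_(m + 1)) := exists x (t s : R),
  [/\ in_cone K x, dotv q x = 0, 0 <= t, 0 < s
    & w = col_mx (A *m x - t *: b) (dotv c x - t * p + s)%:M].
have [||||l [lP [_ [x1 [t1 [s1 [x1K qx1 t1_ge0 s1_gt0 ->]]]]] lw]] :=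
  @proper_separation R (m + 1) C.
- move=> _ _ [x [t [s [xK qx t0 s0 ->]]]] [x' [t' [s' [x'K qx' t'0 s'0 ->]]]].
  exists (x + x'), (t + t'), (s + s').
  split; rewrite ?addr_ge0 ?addr_gt0 //; first exact: in_coneD.
    by rewrite dotvDr qx qx' addr0.
  rewrite add_col_mx; congr (col_mx _ _).
    by rewrite mulmxDr scalerDl opprD addrACA.
  by rewrite -raddfD; congr _%:M; rewrite dotvDr /=; ring.
- move=> a _ a0 [x [t [s [xK qx t0 s0 ->]]]].
  exists (a *: x), (a * t), (a * s); split; rewrite ?mulr_gt0 //.
  + by apply: in_coneZ => //; apply: ltW.
  + by rewrite dotvZr qx mulr0.
  + by rewrite mulr_ge0 // ltW.
  + rewrite scale_col_mx -scalemxAr -scalerA -scalerBr scale_scalar_mx.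
    by congr (col_mx _ _); congr _%:M; rewrite dotvZr; ring.
(* If 0 were in [C]: for $t>0$ the point $x/t$ would be feasible with value below [p]; for $t=0$,
   [x] would be a recession direction with $\langle c,x\rangle<0$, and values along the ray from
   [x0] would fall below [p]. *)
- move=> [x [t [s [xK qx t0 s0 /esym/eqP]]]]; rewrite col_mx_eq0.
  move=> /andP[/eqP Ax /eqP/(congr1 (fun M : 'M_1 => M ord0 ord0))].
  rewrite !mxE eqxx mulr1n => cx; move/eqP: Ax; rewrite subr_eq0 => /eqP Ax.
  move: t0; rewrite le_eqVlt => /orP[/eqP t0|t0]; last first.
    have /pF : primal_feasible K A b (t^-1 *: x).
      split; last by apply: in_coneZ => //; rewrite invr_ge0 ltW.
      by rewrite -scalemxAr Ax scalerA mulVf ?scale1r // gt_eqF.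
    by rewrite dotvZr ler_pdivlMl //; lra.
  rewrite -t0 scale0r in Ax; rewrite -t0 in cx.
  suff : 0 <= dotv c x by lra.
  apply: (@ray_ge0 _ _ (dotv c x0 - p)) => r r0.
  have /pF : primal_feasible K A b (x0 + r *: x).
    split; first by rewrite mulmxDr -scalemxAr Ax scaler0 addr0.
    by apply: in_coneD => //; apply: in_coneZ.
  by rewrite dotvDr dotvZr; lra.
- eexists; exists 0, 0, 1; split=> //; first exact: in_cone0.
  exact: dotv0r.
pose mu := usubmx l; pose sg : R := dsubmx l ord0 ord0.
have lE x (t s : R) : dotv l (col_mx (A *m x - t *: b) (dotv c x - t * p + s)%:M) =
    dotv (A^T *m mu) x - t * dotv b mu + sg * (dotv c x - t * p + s).
  rewrite -{1}(vsubmxK l) dotv_col_mx dotvBr dotvZr (dotvC mu b).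
  rewrite (mx11_scalar (dsubmx l)) dotv_scalar -/sg; congr (_ - _ + _).
  by rewrite dotvC dotv_mulmxl dotvC.
rewrite lE in lw; have {}lP x (t s : R) :
    in_cone K x -> dotv q x = 0 -> 0 <= t -> 0 < s ->
    0 <= dotv (A^T *m mu) x - t * dotv b mu + sg * (dotv c x - t * p + s).
  by move=> xK qx t0 s0; rewrite -lE; apply: lP; exists x, t, s.
have K0 := in_cone0 R K; have q0 := dotv0r q.
(* The next three facts specialise [lP]: at $x=0$, $t=0$; then along growing [t]; then along growing
   multiples of [x]. *)
have sg0 : 0 <= sg.
  by have := lP 0 0 1 K0 q0 (lexx _) ltr01; rewrite !dotv0r; lra.
have bp : 0 <= - (dotv b mu + sg * p).
  apply: (@ray_ge0 _ _ sg) => t t0.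
  by have := lP 0 t 1 K0 q0 t0 ltr01; rewrite !dotv0r; lra.
have cP x : in_cone K x -> dotv q x = 0 ->
    0 <= dotv (A^T *m mu) x + sg * dotv c x.
  move=> xK qx; apply: (@ray_ge0 _ _ sg) => t t0.
  have := lP (t *: x) 0 1 (in_coneZ t0 xK) _ (lexx _) ltr01.
  by rewrite !dotvZr qx mulr0 => /(_ erefl); lra.
have [sgE|sgn0] := eqVneq sg 0.
  right; exists mu; rewrite sgE in lw bp cP.
  have bmu : dotv b mu = 0.
    have := cP x0 x0K (qF _ x0F).
    by rewrite dotv_mulmxl trmxK Ax0 (dotvC mu); lra.
  (* Properness enters here: if $A^T\mu$ were orthogonal to the face, the functional would vanish at
     the point where it is strictly positive. *)
  split=> // [x xK qx|orth]; first by have := cP x xK qx; lra.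
  by move: lw; rewrite orth // bmu mulr0 mul0r subrr addr0 ltxx.
have {}sg0 : 0 < sg by rewrite lt0r sgn0.
left; exists (- (sg^-1 *: mu)).
  by rewrite dotvNr dotvZr -mulrN ler_pdivlMl //; lra.
move=> x xK qx; rewrite mulmxN opprK -scalemxAr dotvDl dotvZl.
rewrite -(pmulr_rge0 _ sg0) mulrDr mulrA mulfV // mul1r addrC.
exact: cP.
Qed.

(** The first [k] homogeneous levels of the displayed dual, with [qs j] playing $q_j$, [lam j]
    $\lambda_{j+1}$ and [zs j] $z_{j+1}$. The convention $q_0=0$ encodes $z_1=0$, by [tan'0]. *)
Definition chain k q : Prop :=
  exists lam (qs zs : nat -> 'cV[R]_(cdim K)),
  [/\ qs 0%N = 0, qs k = q &
    forall j, (j < k)%N ->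
      [/\ dotv b (lam j) = 0, A^T *m lam j = qs j.+1 + zs j,
          in_cone K (qs j.+1) & tan' K (qs j) (zs j)]].

Lemma chainZ a k q : 0 <= a -> chain k q -> chain k (a *: q).
Proof.
move=> a0 [lam [qs [zs [qs0 qsk h]]]].
exists (fun j => a *: lam j), (fun j => a *: qs j), (fun j => a *: zs j).
split=> [||j /h[bl yl qK t]]; rewrite ?qs0 ?qsk ?scaler0 //; split.
- by rewrite dotvZr bl mulr0.
- by rewrite -scalemxAr yl scalerDr.
- exact: in_coneZ.
- exact: tan'Z.
Qed.

Lemma chain_rcons k q lam q' z : chain k q -> dotv b lam = 0 ->
  A^T *m lam = q' + z -> in_cone K q' -> tan' K q z -> chain k.+1 q'.
Proof.
move=> [lams [qs [zs [qs0 qsk h]]]] bl yl q'K t.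
exists (fun j => if (j < k)%N then lams j else lam).
exists (fun j => if (j <= k)%N then qs j else q').
exists (fun j => if (j < k)%N then zs j else z).
split=> [||j]; rewrite ?ltnn //.
rewrite ltnS leq_eqVlt => /orP[/eqP ->|jk]; last first.
  by rewrite jk orbT; apply: h.
by rewrite ltnn eqxx qsk.
Qed.

(* Requiring the element of the range of A^T to be q up to the orthogonal of the
   face cut out by q itself keeps the faces of successive steps nested, although
   tan' only sees the last q. *)
Definition reducing k q : Prop :=
  [/\ chain k q, in_cone K q,
      forall x, primal_feasible K A b x -> dotv q x = 0
    & exists2 lam, dotv b lam = 0 & orth_cone_face q (A^T *m lam - q)].

Lemma reducing0 : reducing 0 0.
Proof.
split.
- by exists (fun=> 0), (fun=> 0), (fun=> 0).
- exact: in_cone0.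
- by move=> x _; rewrite dotv0l.
- by exists 0; rewrite ?dotv0r // mulmx0 subrr => x _ _; rewrite dotv0l.
Qed.

(** The new level uses $\lambda+\mu$, so its image under $A^T$ is $q+q'$ up to a vector orthogonal
    to the face of $q$. That vector is tangent at a multiple $aq$, and scaling the earlier levels by
    $a$ makes $aq$ their last element. *)
Lemma reducingS k q mu q' : reducing k q -> dotv b mu = 0 ->
  in_cone K q' -> orth_cone_face q (A^T *m mu - q') ->
  reducing k.+1 (q + q').
Proof.
move=> [ch qK qF [lam bl lq]] bm q'K mq.
have yE : A^T *m (lam + mu) - (q + q') = (A^T *m lam - q) + (A^T *m mu - q').
  by rewrite mulmxDr opprD addrACA.
have yq : orth_cone_face q (A^T *m (lam + mu) - (q + q')).
  by move=> x xK qx; rewrite yE dotvDl lq // mq // addr0.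
have bly : dotv b (lam + mu) = 0 by rewrite dotvDr bl bm addr0.
split.
- have [a a0 t] := orth_tan' qK yq.
  apply: (chain_rcons (chainZ a0 ch) bly _ _ t); last exact: in_coneD.
  by rewrite [RHS]addrC subrK.
- exact: in_coneD.
(* For feasible [x], $\langle q',x\rangle=\langle A^T\mu,x\rangle=\langle\mu,b\rangle=0$. *)
- move=> x xF; have qx := qF x xF; have [Ax xK] := xF.
  have := mq x xK qx; rewrite dotvBl dotv_mulmxl trmxK Ax (dotvC mu) bm sub0r.
  by move=> /eqP; rewrite oppr_eq0 => /eqP q'x; rewrite dotvDl qx q'x addr0.
- exists (lam + mu) => // x xK; rewrite dotvDl => /eqP.
  rewrite paddr_eq0 ?in_cone_dot_ge0 // => /andP[/eqP qx _].
  exact: yq.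
Qed.

(** The reduction may stop early while the dual has a fixed number of levels; steps with $\mu=0$ and
    $q'=0$ fill the gap. *)
Lemma reducing_pad k r q : reducing k q -> reducing (k + r) q.
Proof.
elim: r => [|r IHr] h; first by rewrite addn0.
rewrite addnS -[q]addr0; apply: (reducingS (mu := 0) (IHr h)).
- exact: dotv0r.
- exact: in_cone0.
- by rewrite mulmx0 subrr => x _ _; rewrite dotv0l.
Qed.

(** Induction on the bound [r] for the rank: every reduction lowers the rank strictly, and at rank 0
    none is possible. *)
Lemma reducing_attained p r k q :
  (exists x, primal_feasible K A b x) ->
  (forall x, primal_feasible K A b x -> p <= dotv c x) ->
  reducing k q -> (cone_rank q <= r)%N ->
  exists2 q', reducing (k + r) q' &
  exists2 eta, p <= dotv b eta &
    forall x, in_cone K x -> dotv q' x = 0 -> 0 <= dotv (c - A^T *m eta) x.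
Proof.
move=> xF pF; elim: r k q => [|r IHr] k q red qr; have [_ qK qF _] := red.
  have [|[mu [bm mF nmu]]] := attainment_or_reduction qK xF qF pF.
    by exists q; first exact: reducing_pad.
  have [q' [_ _ []//]] := cone_face_dual_decomp qK mF.
  by move: qr; rewrite leqn0 => /eqP ->.
have [|[mu [bm mF nmu]]] := attainment_or_reduction qK xF qF pF.
  by exists q; first exact: reducing_pad.
have [q' [q'K mq []//lt]] := cone_face_dual_decomp qK mF.
rewrite addnS -addSn; apply: IHr (reducingS red bm q'K mq) _.
by rewrite -ltnS (leq_trans lt).
Qed.

Lemma displayed_dual_attained p :
  (exists x, primal_feasible K A b x) ->
  (forall x, primal_feasible K A b x -> p <= dotv c x) ->
  exists eta lam (y q z : 'I_(rank K).+1 -> 'cV[R]_(cdim K)),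
    p <= dotv b eta /\ displayed_dual A b c eta lam y q z.
Proof.
move=> xF pF; have rk : (cone_rank (0 : 'cV[R]_(cdim K)) <= rank K)%N.
  by rewrite cone_rank0.
have [q [ch qK qF _] [eta pe eF]] := reducing_attained xF pF reducing0 rk.
have [q' [q'K qz _]] := cone_face_dual_decomp qK eF.
have [a a0 t] := orth_tan' qK qz; rewrite add0n in ch.
have [lam [qs [zs [qs0 qsT h]]]] := chainZ a0 ch.
pose q1 (j : 'I_(rank K).+1) := if (j < rank K)%N then qs j.+1 else q'.
pose z1 (j : 'I_(rank K).+1) :=
  if (j < rank K)%N then zs j else c - A^T *m eta - q'.
exists eta, (fun j => lam j), (fun j => q1 j + z1 j), q1, z1; split=> //; split.
- by move=> j; rewrite /q1 /z1 lift_max ltn_ord; have [? <-] := h j (ltn_ord j).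
- by rewrite /q1 /z1 /= ltnn addrC subrK.
- by move=> j; split=> //; rewrite /q1; case: ifP => // /h[].
(* If [rank K] is 0, the first level is also the last, and its [z] is tangent at 0. *)
- rewrite /z1 /=; case: ifP => [/h[_ _ _]|/negbT].
    by rewrite qs0; apply: tan'0.
  rewrite -eqn0Ngt => /eqP T0; move: t; rewrite -qsT T0 qs0; exact: tan'0.
- move=> j; rewrite /q1 /z1 lift_max ltn_ord lift0.
  case: ifP => [/h[]//|/negbT]; rewrite -leqNgt => Tj.
  suff -> : j.+1 = rank K by rewrite qsT.
  by apply/eqP; rewrite eqn_leq Tj ltn_ord.
Qed.

(** By induction on the level each $z_j$ is orthogonal to [x]: then $\langle
    q_j,x\rangle=\langle\lambda_j,b\rangle=0$, and $z_{j+1}$ is orthogonal to the face of $q_j$. At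
    the last level $\langle c,x\rangle-b^T\eta=\langle q_{T+1},x\rangle\ge0$. *)
Lemma displayed_dual_bound eta lam (y q z : 'I_(rank K).+1 -> _) x :
  displayed_dual A b c eta lam y q z -> primal_feasible K A b x ->
  dotv b eta <= dotv c x.
Proof.
move=> [yl ym yq z0 zt] [Ax xK].
have zx n (j : 'I_(rank K).+1) : j = n :> nat -> dotv (z j) x = 0.
  elim: n j => [|n IHn] j jn.
    by rewrite (_ : j = ord0) ?z0 ?dotv0l //; apply/val_inj.
  case: (unliftP ord0 j) jn => [j'|] -> // [j'n]; rewrite /bump /= in j'n.
  have [yE qK] := yq (lift ord_max j'); have [ylj bl] := yl j'.
  apply: (tan'_orth qK (zt j')) => //.
  have := congr1 (fun v => dotv v x) yE.
  rewrite dotvDl IHn ?addr0; last by rewrite lift_max.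
  by rewrite ylj dotv_mulmxl trmxK Ax dotvC bl => <-.
have [yE qK] := yq ord_max.
have := in_cone_dot_ge0 qK xK.
have -> : q ord_max = y ord_max - z ord_max by rewrite yE addrK.
rewrite dotvBl (zx _ _ erefl) subr0 ym dotvBl dotv_mulmxl trmxK Ax subr_ge0.
by rewrite dotvC.
Qed.

End FacialReduction.

(** * Size of the expanded program *)

Lemma card_rmap n : (#|{: rmap n}| <= (n ^ 2).+1)%N.
Proof.
rewrite card_option card_sig ltnS.
by apply: leq_trans (max_card _) _; rewrite card_prod card_ord.
Qed.

(** In $S_{ij}J$ only row $i$ (in column $j$) and row $j$ (in column $i$) can be nonzero, since $J$
    merely rescales columns. *)
Lemma size_rmap_mx_row (R : pzRingType) n (r : rmap n) (a : 'I_n) :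
  (size [seq k <- enum 'I_n | rmap_mx R r a k != 0%R] <= 1)%N.
Proof.
rewrite -sum1_size big_filter big_enum_cond sum1_card.
apply/card_le1_eqP => k k'; rewrite !unfold_in /=.
case: r => [[[i j] /= ij]|]; last first.
  rewrite !mxE; have [<-|_] := eqVneq a k; last by rewrite eqxx.
  by have [<-|_] := eqVneq a k'; last by rewrite eqxx.
rewrite mul_mx_diag !mxE.
have Sk (l : 'I_n) (x : R) :
    (((a == i) && (l == j))%:R - ((a == j) && (l == i))%:R) * x != 0 ->
    (a = i /\ l = j) \/ (a = j /\ l = i).
  have [/andP[/eqP -> /eqP ->]|_] := boolP ((a == i) && (l == j)).
    by left.
  have [/andP[/eqP -> /eqP ->]|_] := boolP ((a == j) && (l == i)).
    by right.
  by rewrite subrr mul0r eqxx.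
have {}ij : i <> j by move=> E; rewrite E ltnn in ij.
move=> Sk1 Sk2; have := Sk _ _ Sk1; have := Sk _ _ Sk2.
by move=> [[-> ->]|[-> ->]] [[h ->]|[h ->]] //; case: ij.
Qed.

Section Size.
Variables (R : rcfType) (nu : nat) (K : 'I_nu -> block) (m : nat).
Variables (A : 'M[R]_(m, cdim K)) (b : 'cV[R]_m) (c : 'cV[R]_(cdim K)).
Local Notation T := (rank K).
Local Notation card_r i := #|{: rmap (bdim (K i))}|.

Lemma sum_dvar (f : dvar K -> nat) :
  (\sum_x f x = f Eta + \sum_j f (Lam j) + \sum_j \sum_i f (Q j i)
    + \sum_j \sum_i f (W j i) + \sum_j \sum_i \sum_r f (@Vp _ K j i r)
    + \sum_j \sum_i \sum_r f (@Vm _ K j i r))%N.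
Proof.
rewrite (reindex (@dvar_decode nu K)); last first.
  exists (@dvar_encode nu K) => x _; last exact: dvar_encodeK.
  by case: x => [[[[[[]|j]|[j i]]|[j i]]|[j [i r]]]|[j [i r]]].
rewrite !big_sumType /= -!addnA; congr (_ + _)%N.
  by rewrite (big_pred1 tt) // => -[].
congr (_ + (_ + (_ + (_ + _))))%N.
- by rewrite pair_big; apply: eq_bigr => -[].
- by rewrite pair_big; apply: eq_bigr => -[].
- under [RHS]eq_bigr do rewrite sig_big_dep.
  by rewrite pair_big; apply: eq_bigr => -[j [i r]].
- under [RHS]eq_bigr do rewrite sig_big_dep.
  by rewrite pair_big; apply: eq_bigr => -[j [i r]].
Qed.

Lemma size_y_expr j i a : (size (@y_expr R nu K m A c j i a) <= m.+1)%N.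
Proof.
by rewrite /y_expr; case: unliftP => [j'|] _; rewrite /= size_map size_enum_ord.
Qed.

Lemma size_z_expr j i a : (size (@z_expr R nu K m j i a) <= 2 * card_r i)%N.
Proof.
rewrite /z_expr; case: unliftP => [j'|] _ //.
rewrite size_flatten /shape -map_comp sumnE big_map big_enum /=.
rewrite mulnC -sum_nat_const; apply: leq_sum => r _.
rewrite size_flatten /shape -map_comp sumnE big_map /= big_const_seq.
rewrite count_predT iter_addn_0.
by apply: (@leq_mul 2 _ 2 1) => //; apply: size_rmap_mx_row.
Qed.

Lemma size_y_equation j i a :
  (size (@y_equation R nu K m A c j i a) <= m + 2 + 2 * card_r i)%N.
Proof.
rewrite /y_equation size_cat size_map /=.
have := size_y_expr j a; have := size_z_expr j a; lia.
Qed.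

Lemma size_tan_equation j i a :
  size (@tan_equation R nu K m j i a) = (2 + 2 * card_r i)%N.
Proof.
rewrite /= size_map size_flatten /shape -map_comp sumnE big_map big_enum /=.
by rewrite sum_nat_const mulnC.
Qed.

(* Every map of R_i has at most one nonzero entry per row, so that a coordinate
   of block i costs O(|R_i|) = O(n_i^2) occurrences. *)
Lemma formulation_size_dsocp : (0 < nu)%N ->
  (formulation_size (dsocp K A b c) <=
    40 * (T * \sum_(i < nu) bdim (K i) ^ 3 + T * data_size m (cdim K)))%N.
Proof.
move=> nu0; set N3 := (\sum_i bdim (K i) ^ 3)%N; set n := cdim K.
have bd_gt0 i : (0 < bdim (K i))%N by case: (K i).
have T0 : (0 < T)%N.
  rewrite /rank (bigD1 (Ordinal nu0)) //= addn_gt0; apply/orP; left.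
  by case: (K _).
have n0 : (0 < n)%N.
  by rewrite /n (bigD1 (Ordinal nu0)) //= addn_gt0 bd_gt0.
have nN3 : (n <= N3)%N.
  apply: leq_sum => i _; rewrite -{1}[bdim (K i)]expn1.
  by rewrite leq_pexp2l.
have rN3 : (\sum_i bdim (K i) * card_r i <= 2 * N3)%N.
  rewrite big_distrr /=; apply: leq_sum => i _.
  have := card_rmap (bdim (K i)); have := bd_gt0 i; nia.
have vars : (\sum_x ddim (@dvar_dom nu K m x) <=
    m + T * m + T.+1 * n + T * n + T * (2 * N3) + T * (2 * N3))%N.
  rewrite sum_dvar /= !sum_nat_const !card_ord !leq_add // leq_mul2l;
  apply/orP; right; apply: leq_trans rN3; apply: leq_sum => i _;
  by rewrite sum_nat_const mulnC.
have eqs : (size (dual_equations A b c) +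
    \sum_(e <- dual_equations A b c) size e <=
    T * m.+1 + T.+1 * (n * (m + 3) + 2 * (2 * N3))
    + T * (n * 3 + 2 * (2 * N3)))%N.
  rewrite -sum1_size -big_split /= !big_cat /= big_map !big_allpairs_dep /=.
  rewrite !big_enum /= -addnA; apply: leq_add; last apply: leq_add.
  - rewrite -[X in (_ <= X * _)%N]card_ord -sum_nat_const; apply: leq_sum => j _.
    by rewrite size_map size_enum_ord.
  - rewrite -[X in (_ <= X * _)%N]card_ord -sum_nat_const; apply: leq_sum => j _.
    rewrite big_enum /=.
    apply: leq_trans (_ : (\sum_i bdim (K i) * (m + 3 + 2 * card_r i) <= _)%N).
      under [leqRHS]eq_bigr => i _ do rewrite -{1}[bdim (K i)]card_ord -sum_nat_const.
      rewrite sig_big_dep; apply: leq_sum => -[i a] _ /=.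
      by have := size_y_equation j a; lia.
    under eq_bigr do rewrite mulnDr mulnCA.
    by rewrite big_split -big_distrl -big_distrr /= leq_add2l leq_mul2l.
  - rewrite -[X in (_ <= X * _)%N]card_ord -sum_nat_const; apply: leq_sum => j _.
    rewrite big_enum /=.
    apply: leq_trans (_ : (\sum_i bdim (K i) * (3 + 2 * card_r i) <= _)%N).
      under [leqRHS]eq_bigr => i _ do rewrite -{1}[bdim (K i)]card_ord -sum_nat_const.
      rewrite sig_big_dep; apply: leq_sum => -[i a] _.
      by have /= -> := size_tan_equation j a.
    under eq_bigr do rewrite mulnDr mulnCA.
    by rewrite big_split -big_distrl -big_distrr /= leq_add2l leq_mul2l.
rewrite /formulation_size /= size_map size_enum_ord /data_size -/n -/N3.
(* Positivity of [T] and [n] absorbs every lower-order term into the two products of the bound; the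
   constant 40 leaves slack. *)
have mT := leq_pmull m T0; have nT := leq_pmull n T0; have Tn := leq_pmulr T n0.
have N3T := leq_pmull N3 T0; have mnT := leq_pmull (m * n) T0.
move: vars eqs; move: (size _) (\sum_(e <- _) _)%N (\sum_x _)%N => e1 e2 v.
by clear -mT nT Tn N3T mnT; move: N3 n T mT nT Tn N3T mnT; lia.
Qed.

End Size.

(** * Transfer of the bound, attainment and size to the expanded program *)

Theorem theorem3p5 :
  exists C : nat,
  forall (R : realType) (nu : nat) (K : 'I_nu -> block) (m : nat)
    (A : 'M[R]_(m, cdim K)) (b : 'cV[R]_m) (c : 'cV[R]_(cdim K)),
  (0 < nu)%N ->
  let D := dsocp K A b c in
  [/\ forall s, feasible D s ->
        forall x, primal_feasible K A b x -> objective D s <= dotv c x,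
      (exists x, primal_feasible K A b x) ->
      (-oo < primal_value K A b c)%E ->
        exists s, [/\ feasible D s,
          (objective D s)%:E = primal_value K A b c
        & forall s', feasible D s' -> objective D s' <= objective D s]
    & (formulation_size D <=
        C * (rank K * \sum_(i < nu) bdim (K i) ^ 3
             + rank K * data_size m (cdim K)))%N].

Proof.
exists 40%N => R nu K m A b c nu0 D.
have bound s x : feasible D s -> primal_feasible K A b x ->
    objective D s <= dotv c x.
  move=> sF xF; rewrite dsocp_objective.
  have [y [z dual]] : exists y z, displayed_dual A b c (s Eta)
      (fun j => s (Lam j)) y (fun j => \mxcol_i s (Q j i)) z.
    by apply/dsocp_displayed; exists s => //; split=> // j i; rewrite mxcolK.
  exact: displayed_dual_bound dual xF.
split; last exact: formulation_size_dsocp.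
  by move=> s sF x; apply: bound.
move=> [x0 x0F] val_gt.
have val_le x : primal_feasible K A b x ->
    (primal_value K A b c <= (dotv c x)%:E)%E.
  by move=> xF; apply: ereal_inf_lbound; exists x.
(* The infimum is a real number: the feasible [x0] bounds it above. *)
have [p pE] : exists p, primal_value K A b c = p%:E.
  case: (primal_value K A b c) (val_le x0 x0F) val_gt => [p||] //.
  by exists p.
have p_le x : primal_feasible K A b x -> p <= dotv c x.
  by move=> /val_le; rewrite pE lee_fin.
have [eta [lam [y [q [z [p_eta dual]]]]]] :=
  displayed_dual_attained (ex_intro _ x0 x0F) p_le.
have [s sF [sE _ _]] : exists2 s, feasible D s &
    [/\ s Eta = eta, forall j, s (Lam j) = lam j
       & forall j i, s (Q j i) = submxcol (q j) i].
  by apply/dsocp_displayed; exists y, z.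
(* The constructed point only satisfies $p\le b^T\eta$; weak duality against all feasible [x] gives
   the reverse inequality and optimality. *)
have le_p s' : feasible D s' -> objective D s' <= p.
  move=> s'F; rewrite -lee_fin -pE; apply: le_ereal_inf_tmp => _ [x xF <-].
  by rewrite lee_fin; apply: bound.
have sp : objective D s = p.
  by apply/le_anti; rewrite le_p //= dsocp_objective sE.
by exists s; split=> //; rewrite sp // pE.
Qed.
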